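(* Let $d \ge 1$ be an integer and $L>0$. There are a constant $c_1>0$ depending only on $(d,L)$ and, for each $s>0$, a constant $c_2(s)>0$ depending only on $(s,d,L)$, such that for every integer $m \ge 2$ and every $a \ge 1$ the multiscale chi-squared test $$\phi = \max_{\kappa}\ \mathbb{I}\{\Gamma_\kappa \ge \tau_\kappa\}, \qquad \tau_\kappa = 2m + a m (\log m)^{1/2} \kappa^{-d/2},$$ the maximum being over $\kappa \in \{2^b : b = 1,\dots,b_{\max}\}$ with $b_{\max} = \lfloor \frac{2}{d}\log_2 m\rfloor$ (ordinary integer part), satisfies $$\sup_{s>0} R_{\varepsilon_s}^{(m,m)}(\phi; \mathcal{H}_s^d(L)) \le c_1/a^2, \quad \text{if } \varepsilon_s \ge c_2(s)\, a\, (\log m)^{1/2} m^{-2s/(4s+d)} \text{ for all } s>0.$$ Moreover $c_2(s)$ is the constant of the corresponding bound for known smoothness, i.e. $c_2(s)$ is also such that, for some constant $c_1'>0$ depending only on $(d,L)$, for all $m \ge 1$ and $a \ge 1$, the single-scale test $\mathbb{I}\{\Gamma_\kappa > 2m + a m\kappa^{-d/2}\}$ with $\kappa = \lfloor m^{2/(4s+d)}\rfloor$ (ordinary integer part) has risk $R_\varepsilon^{(m,m)}(\,\cdot\,;\mathcal{H}_s^d(L)) \le c_1'/a^2$ whenever $\varepsilon \ge c_2(s)\, a\, m^{-2s/(4s+d)}$.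
   Context: Hölder class: for $s>0$, in the definition of the class (only), $\lfloor s \rfloor$ denotes the largest integer strictly smaller than $s$. $\mathcal{H}_s^d(L)$ is the class of functions $f:[0,1]^d \to \mathbb{R}$ having a derivative $f^{(\lfloor s\rfloor)}$ of order $\lfloor s \rfloor$ with $|f^{(\lfloor s \rfloor)}(x) - f^{(\lfloor s \rfloor)}(y)| \le L\|x-y\|^{s-\lfloor s\rfloor}$ for all $x,y\in[0,1]^d$, and such that $\|f^{(s')}\|_\infty \le L$ for all $s' \in \{0,\dots,\lfloor s\rfloor\}$. Here $f^{(k)}$ is the $k$-th order (multilinear) derivative, measured in operator norm, with $f^{(0)} = f$. Two-sample problem with equal sample sizes: $X_1,\dots,X_m$ are i.i.d. with density $f$ and, independently, $Y_1,\dots,Y_m$ are i.i.d. with density $g$, densities being with respect to Lebesgue measure $\nu$ on $[0,1]^d$. For an integer $\kappa\ge1$, $[\kappa] = \{1,\dots,\kappa\}$, and for $k \in [\kappa]^d$ the bin counts are $M_{k,\kappa} = \#\{i : X_i \in ((k-1)/\kappa, k/\kappa]\}$ and $N_{k,\kappa} = \#\{j : Y_j \in ((k-1)/\kappa, k/\kappa]\}$, where $((k-1)/\kappa,k/\kappa] = \prod_{l=1}^d ((k_l-1)/\kappa, k_l/\kappa]$. The chi-squared statistic is $\Gamma_\kappa = \sum_{k \in [\kappa]^d} (M_{k,\kappa} - N_{k,\kappa})^2$. A test $\phi$ is a Borel measurable function of the data with values in $[0,1]$, giving the probability of rejecting the null hypothesis $f=g$ (a maximum over an empty set of scales is $0$).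 $\mathbb{E}_{f,g}^{(m,m)}$ denotes expectation under this model. Let $\delta(f,g) = \|f-g\|_2 = (\int (f-g)^2\,d\nu)^{1/2}$. The worst-case risk of $\phi$ over a class $\mathcal{H}$ is $$R_\varepsilon^{(m,m)}(\phi;\mathcal{H}) = \sup\{\mathbb{E}^{(m,m)}_{f,f}[\phi] : f \in \mathcal{H}\} + \sup\{\mathbb{E}^{(m,m)}_{f,g}[1-\phi] : f,g \in \mathcal{H},\ \delta(f,g) \ge \varepsilon\},$$ where the suprema are over those $f,g$ that are probability densities, with the supremum over the empty set equal to $0$. *)

(* Defs.v *)
From HB Require Import structures.
From mathcomp Require Import all_boot all_order all_algebra.
From mathcomp Require Import all_classical all_reals all_analysis.
From mathcomp Require Import measurable_realfun.

Set Implicit Arguments.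
Unset Strict Implicit.
Unset Printing Implicit Defensive.
Import Order.TTheory GRing.Theory Num.Theory.
Import numFieldNormedType.Exports.

Local Open Scope classical_set_scope.
Local Open Scope ring_scope.

Section iid.
Context d (T : measurableType d) (R : realType).

Definition cons_pair n (z : T * n.-tuple T) : n.+1.-tuple T :=
  [the n.+1.-tuple T of z.1 :: z.2].

Let measurable_cons_pair n :
  measurable_fun [set: T * n.-tuple T] (@cons_pair n).
Proof. exact: measurable_cons. Qed.

HB.instance Definition _ n := @isMeasurableFun.Build _ _
  (T * n.-tuple T)%type (n.+1.-tuple T) (@cons_pair n) (@measurable_cons_pair n).

(* The law of n independent draws from P, i.e. the n-fold product measure:
   the image of P \x iid P n under (x, t) |-> x :: t. *)
Fixpoint iid (P : probability T R) n : probability (n.-tuple T) R :=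
  match n with
  | 0 => \d_([tuple] : 0.-tuple T)
  | k.+1 => distribution (P \x iid P k)%E (@cons_pair k)
  end.

End iid.

(* Points are tuples, on which the library puts the product sigma-algebra;
   displacements between points are row vectors. *)
Definition point (R : realType) (d : nat) := d.-tuple (measurableTypeR R).
HB.instance Definition _ R d := Measurable.on (@point R d).

Section cube.
Context (R : realType) (d : nat).
Local Notation point := (point R d).

Definition coord (x : point) (i : 'I_d) : R := tnth x i.

Definition unit_cube : set point := [set x | forall i, 0 <= coord x i <= 1].

(* uniform_prob on [0, 1] is one-dimensional Lebesgue measure restricted to
   [0, 1], so this is Lebesgue measure on [0, 1]^d. *)
Definition lebesgue_cube : probability point R :=
  iid (uniform_prob (@ltr01 R)) d.

Lemma measurable_coord (i : 'I_d) :
  measurable_fun [set: point] (fun x => coord x i : measurableTypeR R).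
Proof. exact: measurable_tnth. Qed.

Lemma measurable_unit_cube : measurable unit_cube.
Proof.
rewrite (_ : unit_cube =
    \bigcap_(i in [set: 'I_d]) ((coord ^~ i) @^-1` `[0, 1])); last first.
  apply/seteqP; split => [x x01 i _|x x01 i] /=; first by rewrite in_itv/= x01.
  by have := x01 i I; rewrite /= in_itv.
apply: fin_bigcap_measurable => // i _; rewrite -[X in measurable X]setTI.
by apply: (measurable_coord i) => //; exact: measurable_itv.
Qed.

(* A probability density on [0, 1]^d; only its values on the cube matter. *)
Record density := Density {
  density_fun :> point -> R ;
  density_ge0 : forall x, unit_cube x -> 0 <= density_fun x ;
  measurable_density : measurable_fun unit_cube density_fun ;
  density_int1 : (\int[lebesgue_cube]_(x in unit_cube) (density_fun x)%:E = 1)%E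
}.

Definition law (f : density) : set point -> \bar R := fun A =>
  (\int[lebesgue_cube]_(x in A `&` unit_cube) (f x)%:E)%E.

Section law_probability.
Variable f : density.

Let law0 : law f set0 = 0%E.
Proof. by rewrite /law set0I integral_set0. Qed.

Let law_ge0 A : (0 <= law f A)%E.
Proof.
by apply: integral_ge0 => x [_ cx]; rewrite lee_fin density_ge0.
Qed.

Let law_sigma_additive : semi_sigma_additive (law f).
Proof.
move=> F mF tF mUF; rewrite /law; apply: cvg_toP.
  apply: ereal_nondecreasing_is_cvgn => m n mn.
  by apply: lee_sum_nneg_natr => // k _ _; exact: law_ge0.
rewrite setI_bigcupl ge0_integral_bigcup//=.
- by move=> k; apply: measurableI => //; exact: measurable_unit_cube.
- apply/measurable_EFinP; apply: measurable_funS (@measurable_density f).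
    exact: measurable_unit_cube.
  by move=> x [k _ []].
- by move=> x [k _ [_ cx]]; rewrite lee_fin density_ge0.
- apply/trivIsetP => i j _ _ ij.
  move/trivIsetP : tF => /(_ i j Logic.I Logic.I ij) Fij.
  by rewrite setIACA Fij set0I.
Qed.

HB.instance Definition _ := isMeasure.Build _ _ _ (law f)
  law0 law_ge0 law_sigma_additive.

Let law_setT : law f [set: point] = 1%E.
Proof. by rewrite /law setTI density_int1. Qed.

HB.instance Definition _ := @Measure_isProbability.Build _ _ R (law f) law_setT.

End law_probability.

Definition l2_dist (f g : density) : \bar R :=
  ((\int[lebesgue_cube]_(x in unit_cube) ((f x - g x) ^+ 2)%:E) `^ 2^-1)%E.

End cube.

Section hoelder_class.
Context (R : realType) (d : nat).
Local Notation point := (point R d).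
Local Notation cube := (@unit_cube R d).
Local Notation vec := 'rV[R]_d.

Definition eucl_norm (v : vec) : R := Num.sqrt (\sum_(i < d) v ord0 i ^+ 2).

(* The displacement y - x. *)
Definition disp (x y : point) : vec := \row_(i < d) (coord y i - coord x i).

Definition multilinear k (T : k.-tuple vec -> R) := forall (i : 'I_k) h,
  scalar (fun u : vec => T [tuple if j == i then u else tnth h j | j < k]).

Definition op_norm k (T : k.-tuple vec -> R) : \bar R :=
  ereal_sup [set `|T h|%:E | h in [set h | forall i, eucl_norm (tnth h i) <= 1]].

(* F' is the Frechet derivative of F relative to the cube (one-sided at the
   boundary); the new direction is the first argument of F' x. *)
Definition has_derivative_on_cube k (F : point -> k.-tuple vec -> R)
    (F' : point -> k.+1.-tuple vec -> R) :=
  forall x, cube x -> forall e : R, 0 < e -> exists2 r : R, 0 < r &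
    forall y, cube y -> eucl_norm (disp x y) <= r ->
    (op_norm (fun h => F y h - F x h - F' x [tuple of disp x y :: h])%R
       <= (e * eucl_norm (disp x y))%:E)%E.

(* For s > 0, the largest integer strictly smaller than s. *)
Definition strict_floor (s : R) : nat := `|Num.ceil s|%N.-1.

(* F k is the k-th derivative; it is unique on the cube. *)
Definition hoelder_class (s L : R) (f : point -> R) :=
  exists F : forall k, point -> k.-tuple vec -> R,
  [/\ forall x, cube x -> F 0%N x [tuple] = f x,
      forall k x, (k <= strict_floor s)%N -> cube x -> multilinear (F k x),
      forall k, (k < strict_floor s)%N -> has_derivative_on_cube (F k) (F k.+1),
      forall x y, cube x -> cube y ->
        (op_norm (F (strict_floor s) x \- F (strict_floor s) y)%R <=
          (L * eucl_norm (disp y x) `^ (s - (strict_floor s)%:R))%:E)%E &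
      forall k, (k <= strict_floor s)%N ->
        (ereal_sup [set op_norm (F k x) | x in cube] <= L%:E)%E].

End hoelder_class.

Section two_sample.
Context (R : realType) (d m : nat).
Local Notation point := (point R d).
Local Notation sample := (m.-tuple point).

Definition two_sample_expectation (f g : density R d)
    (phi : sample * sample -> R) : \bar R :=
  ('E_(iid (law f) m \x iid (law g) m)[phi])%E.

(* Supremum of a set of nonnegative numbers, 0 for the empty set. *)
Definition sup0 (S : set (\bar R)) : \bar R := maxe 0%E (ereal_sup S).

Definition risk (eps : R) (phi : sample * sample -> R)
    (H : set (point -> R)) : \bar R :=
  (sup0 [set two_sample_expectation f f phi | f in [set f : density R d | H f]] +
   sup0 [set two_sample_expectation fg.1 fg.2 (fun z => 1 - phi z)%R |
     fg in [set fg : density R d * density R d |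
       [/\ H fg.1, H fg.2 & eps%:E <= l2_dist fg.1 fg.2]]])%E.

(* Bins are indexed from 0: the l-th side of bin k is (k_l/kappa, (k_l+1)/kappa]. *)
Definition in_bin (kappa : nat) (k : d.-tuple 'I_kappa) (x : point) : bool :=
  [forall l : 'I_d, ((tnth k l)%:R / kappa%:R < coord x l) &&
                    (coord x l <= (tnth k l).+1%:R / kappa%:R)].

Definition bin_count (kappa : nat) (X : sample) (k : d.-tuple 'I_kappa) : nat :=
  #|[pred i : 'I_m | in_bin k (tnth X i)]|.

Definition chi2_stat (kappa : nat) (z : sample * sample) : R :=
  \sum_(k : d.-tuple 'I_kappa)
    ((bin_count z.1 k)%:R - (bin_count z.2 k)%:R) ^+ 2.

Definition multiscale_threshold (a : R) (kappa : nat) : R :=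
  2 * m%:R + a * m%:R * (ln m%:R) `^ 2^-1 * kappa%:R `^ (- (d%:R / 2)).

Definition max_scale : nat := Num.truncn (2 / d%:R * (ln m%:R / ln 2) : R).

Definition multiscale_test (a : R) (z : sample * sample) : R :=
  \big[Num.max/0]_(1 <= b < max_scale.+1)
    (multiscale_threshold a (2 ^ b)%N <= chi2_stat (2 ^ b)%N z)%R%:R.

Definition single_scale (s : R) : nat :=
  Num.truncn (m%:R `^ (2 / (4 * s + d%:R))).

Definition single_scale_test (s a : R) (z : sample * sample) : R :=
  (2 * m%:R + a * m%:R * (single_scale s)%:R `^ (- (d%:R / 2))
     < chi2_stat (single_scale s) z)%R%:R.

End two_sample.

(* Main.v *)
From mathcomp Require Import all_boot all_order all_algebra ring lra zify.
From mathcomp Require Import all_classical all_reals all_analysis.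
From mathcomp Require Import measurable_realfun.
Require Import Defs.
Set Implicit Arguments.
Unset Strict Implicit.
Unset Printing Implicit Defensive.
Import Order.TTheory GRing.Theory Num.Theory.
Import numFieldNormedType.Exports.
Local Open Scope classical_set_scope.
Local Open Scope ring_scope.

(** The statistic depends on the data only through the bins, so the sampling model
    is first replaced by a finite one (two_sample_expectation_bins): a sample of m
    independent pairs of bins, with laws p and q. Let xi_i be the difference of the
    bin indicators of X_i and Y_i, a vector with one entry per bin and mean
    Delta = p - q. Then Gamma is the squared norm of the sum of the xi_i. Its
    diagonal part, the sum of the |xi_i|^2, is 2 m up to pairs that share a bin.
    Its off-diagonal part is m (m - 1) |Delta|^2 plus a centered linear term plus a
    degenerate U-statistic V (bin_chi2_off_diag). Densities in the class are
    bounded by L, so bin probabilities are at most L kappa^-d, and V has standard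
    deviation of order m kappa^(-d/2) (mean_off_diag_sqr_le), the unit in which the
    threshold exceeds 2 m.

    If f = g then Gamma <= 2 m + V, and the Chebyshev inequality bounds the
    probability of a false alarm by 32 L / a^2 (false_alarm_le).

    If m |Delta|^2 >= 32 a kappa^(-d/2), a miss has probability at most 35 L / a^2
    (miss_le). When a <= kappa^(d/2), the Chebyshev inequality for V and for the
    linear term and the Markov inequality for the shared bins suffice. When
    a > kappa^(d/2), the variance of the linear term is too large for this rate;
    but then m is at most a m kappa^(-d/2), so the whole squared norm of the
    centered sum is of the order of the threshold excess, and the drift m Delta
    beats it by the triangle inequality.

    It remains to derive the drift condition from |f - g|_2 >= eps
    (drift_detected). The point is that binning loses only O(kappa^-s) even for
    s > 1, where the projection on piecewise constant functions is not that
    accurate (smoothing_bias). Cubes of q^d bins are considered, for q large in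
    terms of s and d. Along each axis, f - g is within O(kappa^-s) of a polynomial
    of degree less than s at the scale of such a cube (hoelder_axis_poly), and for
    polynomials a step that is short compared with the scale produces only a small
    fraction of the sup norm (near_poly_oscillation). Hence the oscillation of
    f - g over a bin is at most half of its supremum over the cube, up to
    O(kappa^-s), and the supremum is controlled by the averages of f - g over the
    bins of the cube (block_sup_bound).

    The scale kappa of order n = m^(2/(4s+d)) balances kappa^(-2s) against the
    noise kappa^(d/2) / m. If n is too small for blocks of q bins to fit, the
    required separation exceeds the diameter of the class. The multiscale test is
    the same test with a replaced by a (ln m)^(1/2): a union bound over the
    O(ln m) scales controls false alarms, and one dyadic scale within a factor 2
    of n controls misses with the same separation constant. *)

(** * Independent draws from a finite law *)

Section finite_iid_mean.
Context (R : realFieldType) (W : finType) (rho : W -> R).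

(** The recursion on the first draw makes second moments computable by
    induction on the number of draws, one new draw at a time. *)
Fixpoint iid_mean n (F : seq W -> R) : R :=
  if n is n'.+1 then \sum_o rho o * iid_mean n' (fun w => F (o :: w)) else F [::].

Lemma eq_iid_mean n F G : (forall w, size w = n -> F w = G w) ->
  iid_mean n F = iid_mean n G.
Proof.
elim: n F G => [|n IH] F G FG /=; first exact: FG.
by apply: eq_bigr => o _; congr (_ * _); apply: IH => w sw; apply: FG; rewrite /= sw.
Qed.

Lemma iid_meanD n F G : iid_mean n (fun w => F w + G w) = iid_mean n F + iid_mean n G.
Proof.
elim: n F G => [//|n IH] F G /=.
by rewrite -big_split; apply: eq_bigr => o _; rewrite IH mulrDr.
Qed.

Lemma iid_meanZ n c F : iid_mean n (fun w => c * F w) = c * iid_mean n F.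
Proof.
elim: n F => [//|n IH] F /=.
by rewrite mulr_sumr; apply: eq_bigr => o _; rewrite IH mulrCA.
Qed.

Lemma iid_mean_sum (I : finType) n (F : I -> seq W -> R) :
  iid_mean n (fun w => \sum_i F i w) = \sum_i iid_mean n (F i).
Proof.
elim: n F => [//|n IH] F /=.
rewrite exchange_big; apply: eq_bigr => o _.
by rewrite (IH (fun i w => F i (o :: w))) mulr_sumr.
Qed.

Hypothesis rho_ge0 : forall o, 0 <= rho o.

Lemma le_iid_mean n F G : (forall w, size w = n -> F w <= G w) ->
  iid_mean n F <= iid_mean n G.
Proof.
elim: n F G => [|n IH] F G FG /=; first exact: FG.
apply: ler_sum => o _; apply: ler_wpM2l => //.
by apply: IH => w sw; apply: FG; rewrite /= sw.
Qed.

Hypothesis rho_sum1 : \sum_o rho o = 1.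

Lemma iid_mean_cst n c : iid_mean n (fun=> c) = c.
Proof. by elim: n => [//|n IH] /=; rewrite IH -mulr_suml rho_sum1 mul1r. Qed.

Lemma iid_mean_sum_seq n (f : W -> R) :
  iid_mean n (fun w => \sum_(o <- w) f o) = n%:R * \sum_o rho o * f o.
Proof.
elim: n => [|n IH] /=; first by rewrite big_nil mul0r.
under eq_bigr => o _.
  rewrite (@eq_iid_mean _ _ (fun w => f o + \sum_(i <- w) f i)); last first.
    by move=> w _; rewrite big_cons.
  rewrite iid_meanD iid_mean_cst IH mulrDr; over.
by rewrite big_split /= -mulr_suml rho_sum1 -natr1; ring.
Qed.

Definition centered (f : W -> R) := \sum_o rho o * f o = 0.

(** The cross terms between the first draw and the others vanish because they
    are products of independent centered factors. *)
Lemma iid_mean_covariance n (f g : W -> R) : centered f -> centered g ->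
  iid_mean n (fun w => (\sum_(o <- w) f o) * (\sum_(o <- w) g o)) =
  n%:R * \sum_o rho o * (f o * g o).
Proof.
move=> f0 g0; elim: n => [|n IH] /=; first by rewrite !big_nil !mul0r.
have S0 h : centered h -> iid_mean n (fun w => \sum_(i <- w) h i) = 0.
  by move=> h0; rewrite iid_mean_sum_seq h0 mulr0.
under eq_bigr => o _.
  rewrite (@eq_iid_mean _ _ (fun w => f o * g o + (f o * \sum_(i <- w) g i +
     (g o * (\sum_(i <- w) f i) + (\sum_(i <- w) f i) * (\sum_(i <- w) g i)))));
     last by move=> w _; rewrite !big_cons; ring.
  rewrite !iid_meanD !iid_meanZ iid_mean_cst (S0 g) // (S0 f) // IH !mulr0 !add0r mulrDr; over.
by rewrite big_split /= -mulr_suml rho_sum1 -natr1; ring.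
Qed.

Section features.
Context (B : finType) (eta : W -> B -> R).
Hypothesis eta_centered : forall k, centered (eta ^~ k).

Definition feature_sum (w : seq W) k := \sum_(o <- w) eta o k.

Definition feature_cov k l := \sum_o rho o * (eta o k * eta o l).

(** The sum over i <> j of the inner products of the features of draws i and j:
    a degenerate U-statistic of order two. *)
Definition off_diag (w : seq W) :=
  \sum_k feature_sum w k ^+ 2 - \sum_(o <- w) \sum_k eta o k ^+ 2.

Lemma off_diag_cons o w :
  off_diag (o :: w) = off_diag w + 2 * \sum_k feature_sum w k * eta o k.
Proof.
rewrite /off_diag big_cons.
have -> : \sum_k feature_sum (o :: w) k ^+ 2 = \sum_k eta o k ^+ 2 +
    2 * \sum_k feature_sum w k * eta o k + \sum_k feature_sum w k ^+ 2.
  rewrite mulr_sumr -!big_split; apply: eq_bigr => k _.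
  by rewrite /feature_sum big_cons /=; ring.
by ring.
Qed.

(** A new draw o adds twice the inner product of eta o with the current sum of
    features. This increment is centered given the past, so squares add up, and
    its second moment is 4 times the squared Frobenius norm of the covariance
    matrix of eta times the number of past draws; these numbers sum to n (n - 1) / 2. *)
Lemma iid_mean_off_diag_sqr n : iid_mean n (fun w => off_diag w ^+ 2) =
  2 * n%:R * (n%:R - 1) * \sum_k \sum_l feature_cov k l ^+ 2.
Proof.
elim: n => [|n IH] /=.
  rewrite /off_diag /feature_sum big_nil big1 ?subr0; last first.
    by move=> k _; rewrite big_nil expr0n.
  by rewrite mulr0 !mul0r expr0n.
pose D k := iid_mean n (fun w => off_diag w * feature_sum w k).
have step o : iid_mean n (fun w => off_diag (o :: w) ^+ 2) =
    iid_mean n (fun w => off_diag w ^+ 2) + \sum_k 4 * eta o k * D k +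
    \sum_k \sum_l 4 * (eta o k * eta o l) * (n%:R * feature_cov k l).
  rewrite (@eq_iid_mean _ _ (fun w => off_diag w ^+ 2 +
     \sum_k 4 * eta o k * (off_diag w * feature_sum w k) +
     \sum_k \sum_l 4 * (eta o k * eta o l) *
        (feature_sum w k * feature_sum w l))); last first.
    move=> w _; rewrite off_diag_cons.
    have -> : \sum_k 4 * eta o k * (off_diag w * feature_sum w k) =
        4 * off_diag w * \sum_k feature_sum w k * eta o k.
      by rewrite mulr_sumr; apply: eq_bigr => k _; ring.
    have -> : \sum_k \sum_l 4 * (eta o k * eta o l) *
        (feature_sum w k * feature_sum w l) =
        4 * (\sum_k feature_sum w k * eta o k) ^+ 2.
      rewrite expr2 big_distrlr /= mulr_sumr; apply: eq_bigr => k _.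
      by rewrite mulr_sumr; apply: eq_bigr => l _; ring.
    by ring.
  rewrite !iid_meanD !iid_mean_sum; congr (_ + _ + _); apply: eq_bigr => k _.
    by rewrite iid_meanZ.
  rewrite iid_mean_sum; apply: eq_bigr => l _.
  by rewrite iid_meanZ (iid_mean_covariance n (eta_centered k) (eta_centered l)).
under eq_bigr => o _ do rewrite step IH !mulrDr.
rewrite !big_split /= -mulr_suml rho_sum1 mul1r.
set S := \sum_k \sum_l _.
rewrite [X in _ + X + _](_ : _ = 0); last first.
  under eq_bigr => o _ do rewrite mulr_sumr.
  rewrite exchange_big big1 //= => k _.
  rewrite (_ : \sum_i _ = 4 * D k * \sum_o rho o * eta o k).
    by rewrite eta_centered mulr0.
  by rewrite mulr_sumr; apply: eq_bigr => o _; ring.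
rewrite [X in _ + _ + X](_ : _ = 4 * n%:R * S); first by rewrite -natr1; ring.
under eq_bigr => o _ do rewrite mulr_sumr.
rewrite exchange_big /S mulr_sumr; apply: eq_bigr => k _.
under eq_bigr => o _ do rewrite mulr_sumr.
rewrite exchange_big mulr_sumr; apply: eq_bigr => l _.
rewrite expr2 mulrA [in X in _ = _ * X]/feature_cov mulr_sumr.
by apply: eq_bigr => o _; ring.
Qed.

End features.
End finite_iid_mean.

(** * The bin chi-squared statistic of a sample of pairs *)

Lemma sum_const_seq (R : pzRingType) (I : Type) (w : seq I) (c : R) :
  \sum_(i <- w) c = (size w)%:R * c.
Proof. by rewrite big_const_seq count_predT iter_addr_0 mulr_natl. Qed.

(** A law on the bins is a function on option B, where None stands for the points
    that lie in no bin. *)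
Section bin_indicators.
Context (R : realFieldType) (B : finType) (p : option B -> R).
Hypothesis p_sum1 : \sum_x p x = 1.

Definition centered_indicator (x : option B) k : R := (x == Some k)%:R - p (Some k).

Lemma mean_indicator k (f : option B -> R) :
  \sum_x p x * ((x == Some k)%:R * f x) = p (Some k) * f (Some k).
Proof.
rewrite (bigD1 (Some k)) //= eqxx mul1r big1 ?addr0 // => x /negbTE ->.
by rewrite mul0r mulr0.
Qed.

Lemma mean_centered_indicator k : \sum_x p x * centered_indicator x k = 0.
Proof.
rewrite (eq_bigr (fun x => p x * ((x == Some k)%:R * 1) - p x * p (Some k))).
  by rewrite sumrB mean_indicator -mulr_suml p_sum1 mulr1 mul1r subrr.
by move=> x _; rewrite /centered_indicator; ring.
Qed.

Lemma cov_centered_indicator k l :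
  \sum_x p x * (centered_indicator x k * centered_indicator x l) =
  (k == l)%:R * p (Some k) - p (Some k) * p (Some l).
Proof.
rewrite (eq_bigr (fun x => p x * ((x == Some k)%:R * centered_indicator x l) -
    p (Some k) * (p x * centered_indicator x l))).
  rewrite sumrB mean_indicator -mulr_sumr mean_centered_indicator mulr0 subr0.
  rewrite /centered_indicator (inj_eq Some_inj); ring.
by move=> x _; rewrite {1}/centered_indicator; ring.
Qed.

End bin_indicators.

Section two_sample_bins.
Context (R : realFieldType) (B : finType) (p q : option B -> R).
Hypothesis p_ge0 : forall x, 0 <= p x.
Hypothesis q_ge0 : forall x, 0 <= q x.
Hypothesis p_sum1 : \sum_x p x = 1.
Hypothesis q_sum1 : \sum_x q x = 1.

Definition pair_law (o : option B * option B) : R := p o.1 * q o.2.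

Lemma pair_law_ge0 o : 0 <= pair_law o.
Proof. exact: mulr_ge0. Qed.

Lemma mean_pair_mul f g :
  \sum_o pair_law o * (f o.1 * g o.2) = (\sum_x p x * f x) * \sum_y q y * g y.
Proof.
rewrite big_distrlr /= pair_bigA /=.
by apply: eq_bigr => o _; rewrite /pair_law; ring.
Qed.

Lemma pair_law_sum1 : \sum_o pair_law o = 1.
Proof.
rewrite -[RHS]mul1r -{1}p_sum1 -q_sum1 big_distrlr /= pair_bigA /=.
by apply: eq_bigr.
Qed.

Definition bin_diff (o : option B * option B) k : R :=
  (o.1 == Some k)%:R - (o.2 == Some k)%:R.

Definition bin_drift k := p (Some k) - q (Some k).

Definition drift_sqr := \sum_k bin_drift k ^+ 2.

Definition centered_diff o k := bin_diff o k - bin_drift k.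

Definition bin_chi2 (w : seq (option B * option B)) :=
  \sum_k (\sum_(o <- w) bin_diff o k) ^+ 2.

Lemma centered_diffE o k :
  centered_diff o k = centered_indicator p o.1 k - centered_indicator q o.2 k.
Proof. by rewrite /centered_diff /bin_diff /bin_drift /centered_indicator; ring. Qed.

Lemma centered_diff_centered k : centered pair_law (centered_diff ^~ k).
Proof.
rewrite /centered.
rewrite (eq_bigr (fun o => pair_law o * (centered_indicator p o.1 k * 1) -
    pair_law o * (1 * centered_indicator q o.2 k))).
  rewrite sumrB (mean_pair_mul (centered_indicator p ^~ k) (fun=> 1)).
  rewrite (mean_pair_mul (fun=> 1) (centered_indicator q ^~ k)).
  by rewrite !mean_centered_indicator // mul0r mulr0 subrr.
by move=> o _; rewrite centered_diffE; ring.
Qed.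

(** X and Y are independent, so the covariance of the difference of their bin
    indicators is the sum of two multinomial covariances. *)
Lemma cov_centered_diff k l : feature_cov pair_law centered_diff k l =
  (k == l)%:R * (p (Some k) + q (Some k)) -
  (p (Some k) * p (Some l) + q (Some k) * q (Some l)).
Proof.
rewrite /feature_cov.
pose u := centered_indicator p; pose v := centered_indicator q.
rewrite (eq_bigr (fun o => pair_law o * ((u o.1 k * u o.1 l) * 1) +
   pair_law o * (1 * (v o.2 k * v o.2 l)) - (pair_law o * (u o.1 k * v o.2 l) +
   pair_law o * (u o.1 l * v o.2 k)))); last first.
  by move=> o _; rewrite !centered_diffE -/u -/v; ring.
rewrite sumrB !big_split /= (mean_pair_mul (fun x => u x k * u x l) (fun=> 1)).
rewrite (mean_pair_mul (fun=> 1) (fun x => v x k * v x l)).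
rewrite (mean_pair_mul (u ^~ k) (v ^~ l)) (mean_pair_mul (u ^~ l) (v ^~ k)).
rewrite !mean_centered_indicator // !cov_centered_indicator //.
rewrite /= -!mulr_suml p_sum1 q_sum1; ring.
Qed.

Variable M : R.
Hypothesis p_le : forall k, p (Some k) <= M.
Hypothesis q_le : forall k, q (Some k) <= M.

Lemma sub_sum_bins (f : option B -> R) (f_ge0 : forall x, 0 <= f x) :
  \sum_x f x = 1 -> \sum_k f (Some k) <= 1.
Proof.
move=> <-; rewrite (bigD1 None) //= -[leLHS]add0r lerD //.
rewrite [leRHS](reindex_omap Some id) //=; last by case.
by rewrite le_eqVlt; apply/orP; left; apply/eqP/eq_bigl => k; rewrite eqxx.
Qed.

Hypothesis M_ge0 : 0 <= M.

Lemma sum_bins_mul_le (f g : option B -> R) : (forall x, 0 <= g x) ->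
  \sum_x g x = 1 -> (forall k, f (Some k) <= M) ->
  \sum_k f (Some k) * g (Some k) <= M.
Proof.
move=> g0 g1 fM; rewrite (@le_trans _ _ (\sum_k M * g (Some k))) //.
  by apply: ler_sum => k _; apply: ler_wpM2r.
by rewrite -mulr_sumr -[leRHS]mulr1 ler_wpM2l // sub_sum_bins.
Qed.

(** This bounds the variance of the statistic: a covariance entry is at most the
    diagonal part p_k + q_k plus a rank-two part, and the squared l2 norms of p
    and q are at most M because their entries are at most M and sum to 1. *)
Lemma sum_cov_sqr_le :
  \sum_k \sum_l feature_cov pair_law centered_diff k l ^+ 2 <= 16 * M.
Proof.
pose P k := p (Some k); pose Q k := q (Some k).
have P0 k : 0 <= P k := p_ge0 _.
have Q0 k : 0 <= Q k := q_ge0 _.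
pose SP := \sum_k P k * P k; pose SQ := \sum_k Q k * Q k.
have SP0 : 0 <= SP by apply: sumr_ge0 => k _; apply: mulr_ge0.
have SQ0 : 0 <= SQ by apply: sumr_ge0 => k _; apply: mulr_ge0.
have SPM : SP <= M by apply: (sum_bins_mul_le p_ge0 p_sum1 p_le).
have SQM : SQ <= M by apply: (sum_bins_mul_le q_ge0 q_sum1 q_le).
have SP1 : SP <= 1.
  rewrite (le_trans _ (sub_sum_bins p_ge0 p_sum1)) //; apply: ler_sum => k _.
  rewrite -[leRHS]mulr1 ler_wpM2l // -p_sum1 (bigD1 (Some k)) //= lerDl.
  exact: sumr_ge0.
have SQ1 : SQ <= 1.
  rewrite (le_trans _ (sub_sum_bins q_ge0 q_sum1)) //; apply: ler_sum => k _.
  rewrite -[leRHS]mulr1 ler_wpM2l // -q_sum1 (bigD1 (Some k)) //= lerDl.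
  exact: sumr_ge0.
have diag : \sum_k \sum_l (k == l)%:R * (P k + Q k) ^+ 2 <= 2 * (SP + SQ).
  rewrite /SP /SQ -big_split mulr_sumr; apply: ler_sum => k _ /=.
  rewrite (bigD1 k) //= eqxx big1 => [|l /negbTE]; last first.
    by rewrite eq_sym => ->; rewrite mul0r.
  by rewrite mul1r addr0; have := sqr_ge0 (P k - Q k); nra.
have prod : \sum_k \sum_l (P k * P l + Q k * Q l) ^+ 2 <= 2 * (SP ^+ 2 + SQ ^+ 2).
  rewrite !expr2 /SP /SQ !big_distrlr /= -big_split mulr_sumr.
  apply: ler_sum => k _; rewrite -big_split mulr_sumr; apply: ler_sum => l _ /=.
  by have := sqr_ge0 (P k * P l - Q k * Q l); nra.
rewrite (@le_trans _ _ (2 * (\sum_k \sum_l (k == l)%:R * (P k + Q k) ^+ 2) +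
  2 * \sum_k \sum_l (P k * P l + Q k * Q l) ^+ 2)) //; last first.
  have : SP ^+ 2 <= SP by rewrite expr2 ler_piMr.
  have : SQ ^+ 2 <= SQ by rewrite expr2 ler_piMr.
  by lra.
rewrite !mulr_sumr -big_split; apply: ler_sum => k _ /=.
rewrite !mulr_sumr -big_split; apply: ler_sum => l _ /=.
rewrite cov_centered_diff -/(P k) -/(P l) -/(Q k) -/(Q l).
set a := P k + Q k; set b := _ + Q k * Q l.
case: (k == l); rewrite ?mul1r ?mul0r.
  by have := sqr_ge0 (a + b); nra.
by have := sqr_ge0 b; nra.
Qed.

Lemma drift_sum_centered :
  centered pair_law (fun o => \sum_k centered_diff o k * bin_drift k).
Proof.
rewrite /centered; under eq_bigr => o _ do rewrite mulr_sumr.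
rewrite exchange_big big1 //= => k _.
under eq_bigr => o _ do rewrite mulrA.
by rewrite -mulr_suml centered_diff_centered mul0r.
Qed.

(** Only the multinomial diagonal contributes, since the rank-one parts of the
    covariance are subtracted; the diagonal is at most 2 M. *)
Lemma drift_var_le :
  \sum_o pair_law o * (\sum_k centered_diff o k * bin_drift k) ^+ 2 <=
  2 * M * drift_sqr.
Proof.
rewrite (_ : \sum_o _ = \sum_k \sum_l
   feature_cov pair_law centered_diff k l * (bin_drift k * bin_drift l)).
  rewrite (_ : \sum_k _ = \sum_k (p (Some k) + q (Some k)) * bin_drift k ^+ 2 -
     ((\sum_k p (Some k) * bin_drift k) ^+ 2 +
      (\sum_k q (Some k) * bin_drift k) ^+ 2)).
    rewrite (@le_trans _ _ (\sum_k (p (Some k) + q (Some k)) * bin_drift k ^+ 2)) //.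
      by rewrite gerBl addr_ge0 ?sqr_ge0.
    rewrite /drift_sqr mulr_sumr; apply: ler_sum => k _.
    by apply: ler_wpM2r; rewrite ?sqr_ge0 // mulr2n mulrDl mul1r lerD.
  rewrite !expr2 !big_distrlr /= -big_split -sumrB; apply: eq_bigr => k _ /=.
  rewrite -big_split /= (eq_bigr (fun l => (k == l)%:R * (p (Some k) + q (Some k)) *
    (bin_drift k * bin_drift l) - (p (Some k) * bin_drift k * (p (Some l) * bin_drift l)
      + q (Some k) * bin_drift k * (q (Some l) * bin_drift l)))).
    rewrite sumrB (bigD1 k) //= eqxx big1 => [|l /negbTE]; last first.
      by rewrite eq_sym => ->; rewrite !mul0r.
    by rewrite addr0 mul1r.
  by move=> l _; rewrite cov_centered_diff; ring.
transitivity (\sum_o \sum_k \sum_l pair_law o * (centered_diff o k * centered_diff o l) *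
  (bin_drift k * bin_drift l)).
  apply: eq_bigr => o _; rewrite expr2 big_distrlr mulr_sumr; apply: eq_bigr => k _.
  by rewrite mulr_sumr; apply: eq_bigr => l _ /=; ring.
rewrite exchange_big; apply: eq_bigr => k _ /=.
rewrite exchange_big; apply: eq_bigr => l _ /=.
by rewrite /feature_cov mulr_suml.
Qed.

(** The defect of the squared norm of a difference of bin indicators from its
    generic value 2: it is nonzero only if the two points share a bin or one of
    them lies in no bin. *)
Definition overlap (o : option B * option B) := 2 - \sum_k bin_diff o k ^+ 2.

Lemma bin_diff_sqr o :
  \sum_k bin_diff o k ^+ 2 =
  (o.1 != None)%:R + (o.2 != None)%:R - 2 * \sum_k (o.1 == Some k)%:R * (o.2 == Some k)%:R.
Proof.
have ind (x : option B) : (x != None)%:R = \sum_k (x == Some k)%:R :> R.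
  case: x => [k|]; last by rewrite big1.
  by rewrite (bigD1 k) //= eqxx big1 ?addr0 // => l; rewrite eq_sym (inj_eq Some_inj) => /negbTE->.
rewrite !ind mulr_sumr -big_split -sumrB; apply: eq_bigr => k _ /=.
by rewrite /bin_diff; case: (_ == _); case: (_ == _) => /=; ring.
Qed.

Lemma overlap_ge0 o : 0 <= overlap o.
Proof.
rewrite /overlap bin_diff_sqr.
have : 0 <= \sum_k (o.1 == Some k)%:R * (o.2 == Some k)%:R :> R.
  by apply: sumr_ge0 => k _; apply: mulr_ge0.
by case: (_ != None); case: (_ != None) => /=; lra.
Qed.

Hypothesis p_None : p None = 0.
Hypothesis q_None : q None = 0.

Lemma mean_overlap : \sum_o pair_law o * overlap o <= 2 * M.
Proof.
rewrite (eq_bigr (fun o => pair_law o * ((o.1 == None)%:R * 1) +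
  pair_law o * (1 * (o.2 == None)%:R) +
  2 * \sum_k pair_law o * ((o.1 == Some k)%:R * (o.2 == Some k)%:R))); last first.
  move=> o _; rewrite -mulr_sumr /overlap bin_diff_sqr.
  by case: (o.1 == None); case: (o.2 == None) => /=; ring.
rewrite !big_split /= (mean_pair_mul (fun x => (x == None)%:R) (fun=> 1)).
rewrite (mean_pair_mul (fun=> 1) (fun x => (x == None)%:R)).
have N0 (f : option B -> R) : f None = 0 -> \sum_x f x * (x == None)%:R = 0.
  move=> f0; rewrite (bigD1 None) //= f0 mul0r add0r big1 // => x /negbTE ->.
  by rewrite mulr0.
rewrite !N0 // mul0r mulr0 !add0r -mulr_sumr exchange_big /=.
rewrite ler_pM2l //; under eq_bigr => k _.
  rewrite (mean_pair_mul (fun x => (x == Some k)%:R) (fun x => (x == Some k)%:R)).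
  under eq_bigr do rewrite -[_%:R]mulr1.
  under [X in _ * X]eq_bigr do rewrite -[_%:R]mulr1.
  rewrite (mean_indicator p k (fun=> 1)) (mean_indicator q k (fun=> 1)) !mulr1.
  over.
exact: (sum_bins_mul_le q_ge0 q_sum1 p_le).
Qed.

Lemma sum_bin_diff w k : \sum_(o <- w) bin_diff o k =
  feature_sum centered_diff w k + (size w)%:R * bin_drift k.
Proof.
by rewrite /feature_sum /centered_diff [X in _ = X + _]sumrB sum_const_seq subrK.
Qed.

Definition drift_proj w := \sum_(o <- w) \sum_k centered_diff o k * bin_drift k.

Lemma drift_projE w :
  drift_proj w = \sum_k feature_sum centered_diff w k * bin_drift k.
Proof.
by rewrite /drift_proj exchange_big; apply: eq_bigr => k _; rewrite mulr_suml.
Qed.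

Lemma sum_centered_diff_sqr w :
  \sum_(o <- w) \sum_k centered_diff o k ^+ 2 =
  \sum_(o <- w) \sum_k bin_diff o k ^+ 2 - 2 * drift_proj w - (size w)%:R * drift_sqr.
Proof.
have -> : (size w)%:R * drift_sqr = \sum_(o <- w) drift_sqr.
  by rewrite sum_const_seq.
rewrite /drift_proj mulr_sumr -!sumrB; apply: eq_bigr => o _.
rewrite mulr_sumr -!sumrB; apply: eq_bigr => k _; rewrite /centered_diff; ring.
Qed.

(** The statistic is the squared norm of the sum of the centered features plus
    size w times the drift. *)
Lemma bin_chi2E w : bin_chi2 w = (size w)%:R ^+ 2 * drift_sqr +
  2 * (size w)%:R * drift_proj w + \sum_k feature_sum centered_diff w k ^+ 2.
Proof.
rewrite drift_projE /bin_chi2 /drift_sqr !mulr_sumr -!big_split /=.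
by apply: eq_bigr => k _; rewrite sum_bin_diff; ring.
Qed.

(** The centering constant 2 n of the threshold comes from the diagonal terms,
    up to the overlaps; the drift enters quadratically, with weight n (n - 1), and
    through a centered linear term. *)
Lemma bin_chi2_off_diag w : bin_chi2 w =
  (size w)%:R * ((size w)%:R - 1) * drift_sqr +
  2 * ((size w)%:R - 1) * drift_proj w + off_diag centered_diff w +
  (2 * (size w)%:R - \sum_(o <- w) overlap o).
Proof.
rewrite bin_chi2E /off_diag sum_centered_diff_sqr.
have -> : \sum_(o <- w) overlap o =
    2 * (size w)%:R - \sum_(o <- w) \sum_k bin_diff o k ^+ 2.
  by rewrite /overlap sumrB sum_const_seq mulrC.
ring.
Qed.

End two_sample_bins.

(** * Tail bounds for the bin chi-squared statistic *)

Section two_sample_test.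
Context (R : realFieldType) (B : finType) (p q : option B -> R).
Hypothesis p_ge0 : forall x, 0 <= p x.
Hypothesis q_ge0 : forall x, 0 <= q x.
Hypothesis p_sum1 : \sum_x p x = 1.
Hypothesis q_sum1 : \sum_x q x = 1.
Variable M : R.
Hypothesis M_ge0 : 0 <= M.
Hypothesis p_le : forall k, p (Some k) <= M.
Hypothesis q_le : forall k, q (Some k) <= M.

Let rho := pair_law p q.
Let eta := centered_diff p q.
Let V := off_diag eta.
Let r := drift_sqr p q.

Lemma mean_off_diag_sqr_le n : iid_mean rho n (fun w => V w ^+ 2) <= 32 * M * n%:R ^+ 2.
Proof.
rewrite (iid_mean_off_diag_sqr (pair_law_sum1 p_sum1 q_sum1)
  (centered_diff_centered p_sum1 q_sum1)).
have := sum_cov_sqr_le p_ge0 q_ge0 p_sum1 q_sum1 p_le q_le M_ge0.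
set S := \sum_k _ => SM.
have S0 : 0 <= S by apply: sumr_ge0 => k _; apply: sumr_ge0 => l _; apply: sqr_ge0.
have n0 : 0 <= n%:R :> R by [].
rewrite (@le_trans _ _ (2 * n%:R ^+ 2 * S)) //; last by nra.
by apply: ler_wpM2r => //; nra.
Qed.

Lemma mean_drift_proj_sqr_le n :
  iid_mean rho n (fun w => drift_proj p q w ^+ 2) <= n%:R * (2 * M * r).
Proof.
rewrite (@eq_iid_mean _ _ _ _ _ (fun w => drift_proj p q w * drift_proj p q w)); last first.
  by move=> w _; rewrite expr2.
rewrite (iid_mean_covariance (pair_law_sum1 p_sum1 q_sum1)); last 2 first.
- exact: drift_sum_centered.
- exact: drift_sum_centered.
by rewrite ler_wpM2l //; under eq_bigr do rewrite -expr2; apply: drift_var_le.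
Qed.

(** Without drift only the off-diagonal part fluctuates, and the overlaps can
    only decrease the statistic, so the Chebyshev inequality applies. *)
Lemma chi2_upper_tail n t : p =1 q -> 0 < t ->
  iid_mean rho n (fun w => (2 * n%:R + t <= bin_chi2 R w)%R%:R) <= 32 * M * (n%:R / t) ^+ 2.
Proof.
move=> pq t0; have r0 : r = 0.
  by apply: big1 => k _; rewrite /bin_drift pq subrr expr0n.
have W0 w : drift_proj p q w = 0.
  apply: big1 => o _; apply: big1 => k _.
  by rewrite /bin_drift pq subrr mulr0.
apply: (@le_trans _ _ (iid_mean rho n (fun w => t^-2 * V w ^+ 2))).
  apply: (le_iid_mean (pair_law_ge0 p_ge0 q_ge0)) => w sw.
  have D0 : 0 <= \sum_(o <- w) overlap R o by apply: sumr_ge0 => o _; apply: overlap_ge0.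
  case: (leP (2 * n%:R + t)) => [|_]; last by rewrite mulr_ge0 ?sqr_ge0 // invr_ge0 sqr_ge0.
  rewrite (bin_chi2_off_diag p q) -/r r0 W0 !mulr0 !add0r sw -/eta -/V => tV.
  rewrite mulrC ler_pdivlMr ?mul1r ?exprn_gt0 //.
  by rewrite lerXn2r ?nnegrE ?(ltW t0) //; lra.
rewrite iid_meanZ; have := mean_off_diag_sqr_le n.
rewrite -(ler_pM2l (_ : 0 < t^-2)) ?invr_gt0 ?exprn_gt0 // => /le_trans; apply.
by rewrite expr_div_n le_eqVlt; apply/orP; left; apply/eqP; ring.
Qed.

Hypothesis p_None : p None = 0.
Hypothesis q_None : q None = 0.

Lemma drift_sqr_le2 : r <= 2.
Proof.
rewrite (@le_trans _ _ (\sum_k p (Some k) + \sum_k q (Some k))) //; last first.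
  by rewrite -[2]/(1 + 1) lerD // sub_sum_bins.
rewrite -big_split; apply: ler_sum => k _; rewrite /bin_drift /=.
have le1 (f : option B -> R) : (forall x, 0 <= f x) -> \sum_x f x = 1 -> f (Some k) <= 1.
  by move=> f0 <-; rewrite (bigD1 (Some k)) //= lerDl sumr_ge0.
have := le1 _ p_ge0 p_sum1; have := le1 _ q_ge0 q_sum1.
by have := p_ge0 (Some k); have := q_ge0 (Some k); nra.
Qed.

Lemma sum_centered_diff_sqr_le w :
  \sum_(o <- w) \sum_k eta o k ^+ 2 <= 8 * (size w)%:R.
Proof.
rewrite mulrC -sum_const_seq; apply: ler_sum => o _.
rewrite (@le_trans _ _ (2 * \sum_k bin_diff R o k ^+ 2 + 2 * r)) //.
  rewrite !mulr_sumr -big_split; apply: ler_sum => k _.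
  rewrite /eta /centered_diff /=.
  by have := sqr_ge0 (bin_diff R o k + bin_drift p q k); nra.
by have := drift_sqr_le2; have := overlap_ge0 R o; rewrite /overlap; lra.
Qed.

Lemma bin_chi2_ge w : (size w)%:R ^+ 2 * r / 2 -
  \sum_k feature_sum eta w k ^+ 2 <= bin_chi2 R w.
Proof.
rewrite /bin_chi2 mulr_sumr mulr_suml -sumrB; apply: ler_sum => k _.
rewrite (sum_bin_diff p q) -/eta.
set s := feature_sum _ _ _; set D := bin_drift _ _ _.
by have := sqr_ge0 (2 * s + (size w)%:R * D); nra.
Qed.

(** Here theta plays the part of kappa ^ (- d / 2), so that the bin
    probabilities are of order theta ^ 2, and t is the excess of the threshold
    over 2 n. *)
Section power.
Variables (n : nat) (L theta a : R).
Hypothesis ML : M = L * theta ^+ 2.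
Hypothesis L_gt0 : 0 < L.
Hypothesis theta_gt0 : 0 < theta.
Hypothesis a_gt0 : 0 < a.
Hypothesis n_gt0 : (0 < n)%N.
Hypothesis drift_large : 32 * a * theta <= n%:R * r.

Let t := a * n%:R * theta.

Let nR : 0 < n%:R :> R. Proof. by rewrite ltr0n. Qed.

Let t_gt0 : 0 < t. Proof. by rewrite !mulr_gt0. Qed.

Let mean_V : t^-2 * iid_mean rho n (fun w => V w ^+ 2) <= 32 * L / a ^+ 2.
Proof.
have := mean_off_diag_sqr_le n.
rewrite -(ler_pM2l (_ : 0 < t^-2)) ?invr_gt0 ?exprn_gt0 // => /le_trans; apply.
rewrite ML /t le_eqVlt; apply/orP; left; apply/eqP; field.
by rewrite !gt_eqF.
Qed.

(** If a theta > 1 then n <= t, and the squared norm of the centered sum is at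
    most V + 8 n, hence of order t off an event of probability O(a ^ -2). Since
    |x + y|^2 >= |x|^2 / 2 - |y|^2, a drift with n^2 r >= 32 t dominates. The
    Chebyshev inequality for the linear term would only give O(a ^ -1) here. *)
Lemma chi2_lower_tail_coarse : 1 < a * theta ->
  iid_mean rho n (fun w => (bin_chi2 R w <= 2 * n%:R + t)%R%:R) <= 32 * L / a ^+ 2.
Proof.
move=> at1; apply: le_trans mean_V; rewrite -iid_meanZ.
apply: (le_iid_mean (pair_law_ge0 p_ge0 q_ge0)) => w sw.
case: (leP _ (2 * n%:R + t)) => [le|_]; last by rewrite mulr_ge0 ?sqr_ge0 // invr_ge0 sqr_ge0.
rewrite mulrC ler_pdivlMr ?mul1r ?exprn_gt0 //.
have := bin_chi2_ge w; have := sum_centered_diff_sqr_le w; rewrite sw => h1 h2.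
have nt : n%:R <= t by rewrite /t mulrAC ler_peMl ?ltW.
have tr : 32 * t <= n%:R ^+ 2 * r.
  have := ler_wpM2l (ltW nR) drift_large; rewrite /t expr2.
  by rewrite -mulrA; lra.
suff tV : t <= V w.
  have V0 := le_trans (ltW t_gt0) tV.
  by rewrite lerXn2r ?nnegrE ?(ltW t_gt0).
by have := t_gt0; rewrite /V /off_diag; lra.
Qed.

(** If a theta <= 1, the off-diagonal part, the overlaps and the linear term are
    controlled separately, by the Chebyshev, Markov and Chebyshev inequalities.
    The last two failure probabilities are O(theta / a), which is O(a ^ -2). *)
Lemma chi2_lower_tail_fine : (1 < n)%N -> a * theta <= 1 ->
  iid_mean rho n (fun w => (bin_chi2 R w <= 2 * n%:R + t)%R%:R) <= 35 * L / a ^+ 2.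
Proof.
move=> n1 at1.
have n2 : 2 <= n%:R :> R by rewrite ler_nat.
have nr0 : 0 < n%:R * r by apply: lt_le_trans drift_large; rewrite !mulr_gt0.
have r_gt0 : 0 < r by rewrite -(pmulr_rgt0 _ nR).
have theta_a : theta <= a^-1 by rewrite -ler_pdivlMl // in at1; rewrite mulr1 in at1.
(* a miss forces one of the three summands to be at least 1 *)
apply: (@le_trans _ _ (iid_mean rho n (fun w => t^-2 * V w ^+ 2 +
   (t^-1 * (\sum_(o <- w) overlap R o) + (n%:R * r / 4)^-2 * drift_proj p q w ^+ 2)))).
  apply: (le_iid_mean (pair_law_ge0 p_ge0 q_ge0)) => w sw.
  have D0 : 0 <= \sum_(o <- w) overlap R o by apply: sumr_ge0 => o _; apply: overlap_ge0.
  have V0 : 0 <= t^-2 * V w ^+ 2 by rewrite mulr_ge0 ?sqr_ge0 // invr_ge0 sqr_ge0.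
  have W0 : 0 <= (n%:R * r / 4)^-2 * drift_proj p q w ^+ 2.
    by rewrite mulr_ge0 ?sqr_ge0 // invr_ge0 sqr_ge0.
  have D0' : 0 <= t^-1 * (\sum_(o <- w) overlap R o) by rewrite mulr_ge0 // invr_ge0 ltW.
  case: (leP _ (2 * n%:R + t)) => [le|_]; last by rewrite !addr_ge0.
  have [tV|Vt] := lerP (t ^+ 2) (V w ^+ 2).
    have : 1 <= t^-2 * V w ^+ 2 by rewrite mulrC ler_pdivlMr ?mul1r ?exprn_gt0.
    by move=> h; rewrite -[leLHS]addr0 lerD // addr_ge0.
  have [tD|Dt] := lerP t (\sum_(o <- w) overlap R o).
    have : 1 <= t^-1 * (\sum_(o <- w) overlap R o) by rewrite mulrC ler_pdivlMr ?mul1r.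
    by move=> h; rewrite -[leLHS]add0r lerD // -[leLHS]addr0 lerD.
  have [tW|Wt] := lerP ((n%:R * r / 4) ^+ 2) (drift_proj p q w ^+ 2).
    have : 1 <= (n%:R * r / 4)^-2 * drift_proj p q w ^+ 2.
      by rewrite mulrC ler_pdivlMr ?mul1r ?exprn_gt0 // divr_gt0.
    by move=> h; rewrite -[leLHS]add0r lerD // -[leLHS]add0r lerD.
  exfalso; move: le; apply/negP; rewrite -ltNge.
  rewrite (bin_chi2_off_diag p q) -/r -/eta -/V sw.
  have V1 : - t < V w by have := t_gt0; nra.
  have W1 : - (n%:R * r / 4) < drift_proj p q w by have := nr0; nra.
  have W2 : - ((n%:R - 1) * (n%:R * r / 2)) <= 2 * (n%:R - 1) * drift_proj p q w by nra.
  have tr : 32 * t <= n%:R ^+ 2 * r.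
    have := ler_wpM2l (ltW nR) drift_large; rewrite /t expr2.
    by rewrite -mulrA; lra.
  have nn : n%:R ^+ 2 * r / 4 <= n%:R * (n%:R - 1) * r / 2 by nra.
  by have := t_gt0; lra.
rewrite !iid_meanD !iid_meanZ.
have -> : 35 * L / a ^+ 2 = 32 * L / a ^+ 2 + (2 * L / a ^+ 2 + L / a ^+ 2).
  by field; rewrite gt_eqF.
have La : L * theta / a <= L / a ^+ 2.
  by rewrite expr2 invfM mulrA ler_pM2r ?invr_gt0 // ler_pM2l.
apply: lerD mean_V (lerD _ _).
  rewrite (iid_mean_sum_seq (pair_law_sum1 p_sum1 q_sum1)).
  have mO := mean_overlap q_ge0 q_sum1 p_le M_ge0 p_None q_None.
  apply: le_trans (ler_wpM2l _ (ler_wpM2l (ltW nR) mO)) _.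
    by rewrite invr_ge0 ltW.
  have -> : t^-1 * (n%:R * (2 * M)) = 2 * (L * theta / a).
    by rewrite ML /t; field; rewrite !gt_eqF.
  by rewrite -[leRHS]mulrA ler_pM2l.
apply: le_trans (ler_wpM2l _ (mean_drift_proj_sqr_le n)) _.
  by rewrite invr_ge0 sqr_ge0.
have -> : (n%:R * r / 4)^-2 * (n%:R * (2 * M * r)) = 32 * L * theta ^+ 2 / (n%:R * r).
  by rewrite ML; field; rewrite !gt_eqF.
rewrite (le_trans _ La) // ler_pdivrMr // (@le_trans _ _ (L * theta / a * (32 * a * theta))) //.
  by rewrite le_eqVlt; apply/orP; left; apply/eqP; field; rewrite gt_eqF.
by rewrite ler_wpM2l // !mulr_ge0 ?invr_ge0 ?ltW.
Qed.

Lemma chi2_lower_tail : (1 < n)%N ->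
  iid_mean rho n (fun w => (bin_chi2 R w <= 2 * n%:R + t)%R%:R) <= 35 * L / a ^+ 2.
Proof.
move=> n1; have [at1|at1] := leP (a * theta) 1; first exact: chi2_lower_tail_fine.
apply: (le_trans (chi2_lower_tail_coarse at1)).
by rewrite ler_pM2r ?invr_gt0 ?exprn_gt0 // ler_pM2r // ler_nat.
Qed.

End power.
End two_sample_test.

(** * Functions of one variable close to a polynomial *)

(** On polynomials of degree at most N, the modulus of continuity at 0 is
    controlled by the sup norm on [0, 1], as all norms on this finite-dimensional
    space are equivalent; A is an admissible constant. *)
Definition increment_const (R : realFieldType) (N : nat) (A : R) :=
  forall (P : {poly R}) (K : R), (size P <= N.+1)%N ->
  (forall x, 0 <= x <= 1 -> `|P.[x]| <= K) ->
  forall u, 0 <= u <= 1 -> `|P.[u] - P.[0]| <= A * u * K.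

Lemma increment_const_exists (R : realFieldType) (N : nat) :
  exists2 A : R, 0 < A & increment_const N A.
Proof.
pose a : 'rV[R]_N.+1 := \row_i (i%:R / N.+1%:R).
pose V := Vandermonde N.+1 a.
have Vu : V \in unitmx.
  rewrite unitmxE det_Vandermonde unitfE; apply/prodf_neq0 => i _.
  apply/prodf_neq0 => j ij; rewrite !mxE -mulrBl mulf_neq0 ?invr_neq0 ?pnatr_eq0 //.
  by rewrite subr_eq0 eqr_nat neq_ltn ij orbT.
pose A := \sum_(j < N.+1) \sum_(i < N.+1) `|invmx V i j|.
have A0 : 0 <= A by apply: sumr_ge0 => j _; apply: sumr_ge0.
(* the coefficients of P are A-bounded combinations of its values at the nodes *)
exists (1 + A); first by rewrite ltr_wpDr.
move=> P K sP PK u /andP[u0 u1].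
have K0 : 0 <= K by rewrite (le_trans _ (PK 0 _)) ?lexx ?ler01.
have PE x : P.[x] = \sum_(j < N.+1) P`_j * x ^+ j by apply: horner_coef_wide.
pose b : 'rV[R]_N.+1 := \row_j P`_j.
pose v : 'rV[R]_N.+1 := \row_i P.[a 0 i].
have bV : b *m V = v.
  by apply/rowP => i; rewrite !mxE PE; apply: eq_bigr => j _; rewrite !mxE.
have bE : b = v *m invmx V by rewrite -bV mulmxK.
have bj (j : 'I_N.+1) : `|P`_j| <= (\sum_i `|invmx V i j|) * K.
  have -> : P`_j = b 0 j by rewrite mxE.
  rewrite bE mxE mulr_suml (le_trans (ler_norm_sum _ _ _)) //.
  apply: ler_sum => i _; rewrite normrM mulrC ler_wpM2l // !mxE; apply: PK.
  by rewrite divr_ge0 //= ler_pdivrMr ?ltr0n // mul1r ler_nat ltnW.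
rewrite !PE -sumrB (le_trans (ler_norm_sum _ _ _)) //.
rewrite (@le_trans _ _ (\sum_(j < N.+1) (\sum_i `|invmx V i j|) * K * u)) //.
  apply: ler_sum => j _; rewrite -mulrBr normrM.
  apply: ler_pM => //; have [->|j0] := posnP j; first by rewrite !expr0 subrr normr0.
  rewrite expr0n gtn_eqF //= subr0 ger0_norm ?exprn_ge0 //.
  by rewrite -(prednK j0) exprS ler_piMr // exprn_ile1.
rewrite -!mulr_suml -/A; have := mulr_ge0 u0 K0; nra.
Qed.

Section taylor.
Context (R : realType).
Implicit Types (f g : R -> R) (tau s B M : R).

(** Differentiability relative to [0, tau], one-sided at the endpoints; this is
    what differentiability relative to the cube gives on a segment. *)
Definition interval_derivative tau f g := forall u, 0 <= u <= tau ->
  forall e, 0 < e -> exists2 r, 0 < r & forall v, 0 <= v <= tau ->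
    `|v - u| <= r -> `|f v - f u - (v - u) * g u| <= e * `|v - u|.

Lemma interval_derivative_continuous tau f g : 0 < tau ->
  interval_derivative tau f g -> {within `[0, tau], continuous f}.
Proof.
move=> tau0 fg; apply/subspace_continuousP => u /=; rewrite in_itv /= => u01.
apply/cvgrPdist_le => /= e e0.
have [r r0 H] := fg u u01 1 ltr01.
pose c := 1 + `|g u|; have c0 : 0 < c by rewrite ltr_wpDr.
rewrite near_withinE; apply/nbhs_ballP.
exists (Num.min r (e / c)) => /=; first by rewrite lt_min r0 divr_gt0.
move=> v /ltW; rewrite distrC => vu; rewrite in_itv /= => v01.
rewrite distrC.
have := H v v01; move: vu; rewrite le_min => /andP[-> vec] /(_ isT).
rewrite mul1r => h.
rewrite -[f v - f u](subrK ((v - u) * g u)) (le_trans (ler_normD _ _)) //.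
rewrite (le_trans (lerD h (lexx _))) // normrM -[X in X + _]mulr1 -mulrDr -/c.
by rewrite -ler_pdivlMr.
Qed.

Lemma interval_derivative_is_derive tau f g u : interval_derivative tau f g ->
  0 < u < tau -> is_derive u 1 f (g u).
Proof.
move=> fg /andP[u0 ut].
suff H : (h^-1 *: ((f \o shift u) (h *: (1 : R)) - f u)) @[h --> 0^'] --> g u.
  by apply: DeriveDef; [apply/cvg_ex; exists (g u)|exact/cvg_lim].
apply/cvgrPdist_le => /= e e0.
have [|r r0 H] := fg u _ e e0; first by rewrite !ltW.
apply/nbhs_ballP; exists (Num.min r (Num.min u (tau - u))) => /=.
  by rewrite !lt_min r0 u0 subr_gt0.
move=> h; rewrite /ball /= sub0r normrN => /ltW hr h0.
move: hr; rewrite !le_min => /and3P[hr hu htu].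
have := H (h + u); rewrite addrK => /(_ _ hr).
have -> : 0 <= h + u <= tau by move: hu htu; rewrite !ler_norml; lra.
move=> /(_ isT) fh; rewrite /= /GRing.scale /= mulr1 distrC.
rewrite -(ler_pM2r (_ : 0 < `|h|)) ?normr_gt0 // -normrM.
by rewrite mulrBl mulrAC mulVf // mul1r [g u * h]mulrC.
Qed.

Lemma poly_antiderivative N (P : {poly R}) c : (size P <= N)%N ->
  exists Q : {poly R}, [/\ (size Q <= N.+1)%N, Q^`() = P & Q.[0] = c].
Proof.
move=> sP.
exists (\poly_(i < N.+1) (if i is j.+1 then P`_j / j.+1%:R else c)); split.
- exact: size_poly.
- apply/polyP => i; rewrite coef_deriv coef_poly ltnS.
  have [iN|Ni] := ltnP i N; last by rewrite mul0rn nth_default // (leq_trans sP).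
  by rewrite /= -[LHS]mulr_natr divfK // pnatr_eq0.
- by rewrite horner_coef0 coef_poly.
Qed.

(** Taylor's theorem with a Hoelder remainder, for a chain of derivatives psi 0,
    ..., psi N. By induction psi 1 is within B u ^ (s - 1) of a polynomial; the
    mean value theorem applied to psi 0 minus an antiderivative of it gains one
    power of u. *)
Lemma taylor_remainder tau N (psi : nat -> R -> R) s B : 0 <= B -> N%:R < s ->
  (forall j, (j < N)%N -> interval_derivative tau (psi j) (psi j.+1)) ->
  (forall u, 0 <= u <= tau -> `|psi N u - psi N 0| <= B * u `^ (s - N%:R)) ->
  exists2 P : {poly R}, (size P <= N.+1)%N &
    forall u, 0 <= u <= tau -> `|psi 0%N u - P.[u]| <= B * u `^ s.
Proof.
move=> B0; elim: N psi s => [|N IH] psi s Ns psiD psiB.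
  exists (psi 0%N 0)%:P; first by rewrite size_polyC; case: eqP.
  by move=> u u01; have := psiB u u01; rewrite hornerC subr0.
have sN1 : N%:R < s - 1 by rewrite ltrBrDr natr1.
have [|u u01|P sP PB] := IH (fun j => psi j.+1) (s - 1) sN1.
- by move=> j jN; apply: psiD.
- by have := psiB u u01; rewrite -natr1 opprD addrA addrAC.
have [Q [sQ QP Q0]] := poly_antiderivative (psi 0%N 0) sP.
exists Q => // u /andP[u0 ut].
move: u0; rewrite le_eqVlt => /predU1P[<-|u0].
  by rewrite Q0 subrr normr0 mulr_ge0 ?powR_ge0.
have tau0 : 0 < tau := lt_le_trans u0 ut.
pose f := psi 0%N - horner Q.
have D := psiD 0%N (ltn0Sn N).
have [||c] := @MVT R f (psi 1%N - horner P) 0 u u0.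
- move=> x; rewrite in_itv /= => /andP[x0 xu]; apply: is_deriveB.
    by apply: interval_derivative_is_derive D _; rewrite x0 (lt_le_trans xu).
  by rewrite -QP; exact: is_derive_poly.
- apply: (@within_continuousB) => /=.
    apply: continuous_subspaceW (interval_derivative_continuous tau0 D).
    by apply: subset_itvl; rewrite bnd_simp.
  by apply: continuous_subspaceT; exact: continuous_horner.
rewrite in_itv /= => /andP[c0 cu].
rewrite /f subr0 !fctE Q0 subrr subr0 => ->.
rewrite normrM (gtr0_norm u0).
have c01 : 0 <= c <= tau by rewrite (ltW c0) (ltW (lt_le_trans cu ut)).
rewrite -[X in _ `^ X](subrK 1) powRD; last by rewrite (gt_eqF u0) implybT.
rewrite powRr1 ?(ltW u0) // mulrA ler_wpM2r ?(ltW u0) //.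
rewrite (le_trans (PB c c01)) // ler_wpM2l //.
apply: ge0_ler_powR; rewrite ?nnegrE ?(ltW c0) ?(ltW u0) ?(ltW cu) //.
by rewrite (le_trans _ (ltW sN1)).
Qed.

(** A Landau-Kolmogorov type inequality: if f is close to a polynomial at scale
    tau, its increment over a short step t is a small multiple t / tau of its sup
    norm, up to the approximation error. The polynomial is rescaled to [0, 1]. *)
Lemma near_poly_oscillation N A : increment_const N A ->
  forall tau s B M (f : R -> R) (P : {poly R}), 0 < tau -> 0 < s -> 0 <= B ->
  (size P <= N.+1)%N ->
  (forall u, 0 <= u <= tau -> `|f u - P.[u]| <= B * u `^ s) ->
  (forall u, 0 <= u <= tau -> `|f u| <= M) ->
  forall t, 0 <= t <= tau ->
  `|f t - f 0| <= A * (t / tau) * (M + B * tau `^ s) + B * t `^ s.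
Proof.
move=> polyA tau s B M f P tau0 s0 B0 sP fP fM t tt.
have P0 : P.[0] = f 0.
  have := fP 0; rewrite lexx (ltW tau0) powR0 ?gt_eqF // mulr0 normr_le0 subr_eq0.
  by move=> /(_ isT)/eqP.
pose Q := P \Po (tau *: 'X).
have QE x : Q.[x] = P.[tau * x] by rewrite horner_comp !hornerE.
have sQ : (size Q <= N.+1)%N.
  rewrite (leq_trans (size_comp_poly_leq _ _)) // ltnS.
  rewrite size_scale ?gt_eqF // size_polyX muln1.
  by case: (size P) sP.
have [t0 tT] := andP tt.
have t01 : 0 <= t / tau <= 1.
  by rewrite divr_ge0 ?(ltW tau0) //= ler_pdivrMr // mul1r.
have QK x : 0 <= x <= 1 -> `|Q.[x]| <= M + B * tau `^ s.
  move=> /andP[x0 x1].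
  have tx : 0 <= tau * x <= tau by rewrite mulr_ge0 ?(ltW tau0) //= ler_piMr ?(ltW tau0).
  rewrite QE -[P.[_]](subrK (f (tau * x))) addrC (le_trans (ler_normD _ _)) //.
  rewrite lerD ?fM // distrC (le_trans (fP _ tx)) // ler_wpM2l //.
  by case/andP: tx => *; apply: ge0_ler_powR; rewrite ?nnegrE ?(ltW s0) ?(ltW tau0).
have := polyA Q _ sQ QK _ t01; rewrite !QE mulr0 P0 mulrCA mulfV ?gt_eqF // mulr1 => h.
rewrite -[f t](subrK P.[t]) -addrA addrC (le_trans (ler_normD _ _)) // lerD //.
exact: fP.
Qed.

End taylor.

(** * Hoelder functions along the coordinate axes *)

Section axis_lines.
Context (R : realType) (d : nat).
Local Notation point := (point R d).
Local Notation cube := (@unit_cube R d).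
Local Notation vec := 'rV[R]_d.

Definition axis_shift (x : point) (l : 'I_d) (t : R) : point :=
  [tuple if i == l then coord x i + t else coord x i | i < d].

Lemma coord_axis_shift x l t i :
  coord (axis_shift x l t) i = if i == l then coord x i + t else coord x i.
Proof. by rewrite /coord tnth_mktuple. Qed.

Definition axis_dir (l : 'I_d) (sigma : R) : vec := sigma *: delta_mx 0 l.

Lemma eucl_norm_axis_dir l c : eucl_norm (axis_dir l c) = `|c|.
Proof.
rewrite /eucl_norm (bigD1 l) //= big1 => [|i /negbTE il]; last first.
  by rewrite !mxE il andbF mulr0 expr0n.
by rewrite !mxE !eqxx mulr1 addr0 sqrtr_sqr.
Qed.

Lemma disp_axis_shift x l sigma u v :
  disp (axis_shift x l (sigma * u)) (axis_shift x l (sigma * v)) =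
  (v - u) *: axis_dir l sigma.
Proof.
apply/rowP => i; rewrite !mxE !coord_axis_shift eqxx /=.
by case: eqP => _ /=; ring.
Qed.

Lemma op_norm_le k (T : k.-tuple vec -> R) c h :
  (op_norm T <= c%:E)%E -> (forall i, eucl_norm (tnth h i) <= 1) -> `|T h| <= c.
Proof.
by move=> Tc h1; rewrite -lee_fin; apply: le_trans Tc; apply: ereal_sup_ubound; exists h.
Qed.

Definition const_dirs k (v : vec) : k.-tuple vec := [tuple v | _ < k].

(** The derivative in direction a v of the k-th derivative evaluated at
    (v, ..., v) is a times the next derivative evaluated at (v, ..., v). *)
Lemma multilinear_head k (T : k.+1.-tuple vec -> R) a v : multilinear T ->
  T [tuple of a *: v :: const_dirs k v] = a * T (const_dirs k.+1 v).
Proof.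
move=> /(_ ord0 (const_dirs k.+1 v)) linT.
have E w : [tuple of w :: const_dirs k v] =
    [tuple if j == ord0 then w else tnth (const_dirs k.+1 v) j | j < k.+1].
  apply: eq_from_tnth => j; rewrite tnth_mktuple.
  case: (unliftP ord0 j) => [i|] -> /=; first by rewrite tnthS !tnth_mktuple.
  by [].
have E' : const_dirs k.+1 v = [tuple of v :: const_dirs k v].
  apply: eq_from_tnth => j; rewrite tnth_mktuple.
  by case: (unliftP ord0 j) => [i|] -> /=; rewrite ?tnthS ?tnth_mktuple.
have TE w b w' : T [tuple of b *: w + w' :: const_dirs k v] =
    b * T [tuple of w :: const_dirs k v] + T [tuple of w' :: const_dirs k v].
  by rewrite !E; exact: linT.
have T0 : T [tuple of 0 :: const_dirs k v] = 0.
  by have := TE 0 1 0; rewrite scaler0 addr0 mul1r; lra.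
by rewrite E' -[a *: v]addr0 TE T0 addr0.
Qed.

Lemma strict_floor_lt (s : R) : 0 < s -> (strict_floor s)%:R < s.
Proof.
move=> s0; rewrite /strict_floor.
have c0 : (0 < Num.ceil s)%R by rewrite ceil_gt0.
have -> : (`|Num.ceil s|%N.-1)%:R = (Num.ceil s - 1)%:~R :> R.
  case: (Num.ceil s) c0 => [[//|n]|//] _ /=.
  by rewrite -addn1 PoszD addrK.
exact: gt_pred_ceil.
Qed.

Variables (s L : R).
Hypothesis s_gt0 : 0 < s.

Lemma hoelder_bounded f : hoelder_class s L f -> forall x, cube x -> `|f x| <= L.
Proof.
move=> [F [F0 _ _ _ FL]] x x01.
rewrite -F0 //; apply: op_norm_le => [|[]//].
apply: le_trans (FL 0%N (leq0n _)); apply: ereal_sup_ubound; exists x => //.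
Qed.

(** On a ray parallel to an axis, the derivatives of f evaluated at the constant
    tuple of directions form a chain as in taylor_remainder. The sign sigma is the
    orientation of the ray. *)
Lemma hoelder_axis_poly f : hoelder_class s L f ->
  forall x l (sigma tau : R), `|sigma| = 1 -> 0 < tau ->
  (forall u, 0 <= u <= tau -> cube (axis_shift x l (sigma * u))) ->
  exists2 P : {poly R}, (size P <= (strict_floor s).+1)%N &
    forall u, 0 <= u <= tau -> `|f (axis_shift x l (sigma * u)) - P.[u]| <= L * u `^ s.
Proof.
move=> Hf x l sigma tau sigma1 tau0 xc.
have z01 : 0 <= (0 : R) <= tau by rewrite lexx ltW.
have L0 : 0 <= L.
  exact: le_trans (normr_ge0 _) (hoelder_bounded Hf (xc 0 z01)).
have [F [F0 Flin FD FH _]] := Hf.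
pose e k := const_dirs k (axis_dir l sigma).
have e1 k i : eucl_norm (tnth (e k) i) <= 1.
  by rewrite tnth_mktuple eucl_norm_axis_dir sigma1.
pose X u := axis_shift x l (sigma * u).
have normX u v : eucl_norm (disp (X u) (X v)) = `|v - u|.
  by rewrite disp_axis_shift scalerA eucl_norm_axis_dir normrM sigma1 mulr1.
pose psi k u := F k (X u) (e k).
have [] := @taylor_remainder R tau (strict_floor s) psi s L L0 (strict_floor_lt s_gt0).
- move=> j jN u u01 eps eps0; have [r r0 H] := FD j jN (X u) (xc u u01) eps eps0.
  exists r => // v v01 vu; have := H (X v) (xc v v01); rewrite normX => /(_ vu) h.
  have := op_norm_le h (e1 j).
  by rewrite disp_axis_shift multilinear_head //; apply: Flin => //; exact: xc.
- move=> u u01.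
  have := op_norm_le (FH (X u) (X 0) (xc u u01) (xc 0 z01)) (e1 _).
  by rewrite normX subr0 [`|u|]ger0_norm; last by case/andP: u01.
- move=> P sP PB; exists P => // u u01; have := PB u u01.
  have -> // : psi 0%N u = f (axis_shift x l (sigma * u)).
  rewrite /psi -F0; last exact: xc.
  by congr (F _ _ _); apply: eq_from_tnth => -[].
Qed.

End axis_lines.

(** * Product measures, finite partitions and bins *)

Section iid_boxes.
Context dsp (T : measurableType dsp) (R : realType) (P : probability T R).

Definition box n (A : 'I_n -> set T) : set (n.-tuple T) :=
  [set t | forall i, A i (tnth t i)].

Lemma measurable_box n (A : 'I_n -> set T) :
  (forall i, measurable (A i)) -> measurable (box A).
Proof.
move=> mA; rewrite (_ : box A =
    \bigcap_(i in [set: 'I_n]) ((fun t => tnth t i) @^-1` A i)).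
  apply: fin_bigcap_measurable => // i _; rewrite -[X in measurable X]setTI.
  exact: (measurable_tnth i).
by apply/seteqP; split => t /= H i => [_|]; exact: H.
Qed.

Lemma iid_box n (A : 'I_n -> set T) : (forall i, measurable (A i)) ->
  iid P n (box A) = (\prod_(i < n) P (A i))%E.
Proof.
elim: n A => [|n IH] A mA /=.
  rewrite big_ord0 diracE mem_set //; by case.
rewrite /distribution /pushforward.
rewrite (_ : _ @^-1` _ = A ord0 `*` box (fun i => A (lift ord0 i))); last first.
  apply/seteqP; split => [[x t] /= H|[x t] /= [H0 H] i].
    split; first exact: (H ord0).
    by move=> i; have := H (lift ord0 i); rewrite tnthS.
  by case: (unliftP ord0 i) => [j|] ->; rewrite ?tnthS //; exact: H.
rewrite product_measure1E //; last exact: measurable_box.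
by rewrite big_ord_recl; congr (_ * _)%E; exact: IH.
Qed.

End iid_boxes.

Section finite_partition.
Context dsp (T : measurableType dsp) (R : realType) (P : probability T R).
Context (K : finType) (c : T -> K).
Hypothesis c_meas : forall k, measurable (c @^-1` [set k]).

Definition cell_prob k : R := fine (P (c @^-1` [set k])).

Lemma cell_probE k : P (c @^-1` [set k]) = (cell_prob k)%:E.
Proof. by rewrite fineK // fin_num_measure. Qed.

Lemma cell_prob_ge0 k : 0 <= cell_prob k.
Proof. exact: fine_ge0. Qed.

Lemma cells_cover : [set: T] = \big[setU/set0]_k (c @^-1` [set k]).
Proof.
rewrite -bigcup_seq; apply/seteqP; split => x //= _.
by exists (c x) => //=; exact: mem_index_enum.
Qed.

Lemma cells_trivIset (D : set K) : trivIset D (fun k => c @^-1` [set k]).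
Proof. by move=> k l _ _ [x [/= -> ->]]. Qed.

Lemma integral_cells (f : T -> \bar R) : measurable_fun setT f ->
  (forall x, 0 <= f x)%E ->
  (\int[P]_x f x = \sum_k \int[P]_(x in c @^-1` [set k]) f x)%E.
Proof.
move=> mf f0; rewrite {1}cells_cover; apply: ge0_integral_bigsetU => //.
- exact: index_enum_uniq.
- exact: cells_trivIset.
- by rewrite -cells_cover.
Qed.

Lemma measurable_cell_fun dsp' (T' : measurableType dsp') (psi : K -> T') :
  measurable_fun setT (psi \o c).
Proof.
move=> _ A mA; rewrite setTI.
rewrite (_ : _ @^-1` A = \bigcup_(k in [set k | A (psi k)]) c @^-1` [set k]).
  by apply: fin_bigcup_measurable => [|k _]; [exact: finite_finset|exact: c_meas].
by apply/seteqP; split => x /= => [Ax|[k Ak ->]] //; exists (c x).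
Qed.

(** This turns expectations of functions of the bin memberships into finite
    sums. *)
Lemma expectation_cells (psi : K -> R) : (forall k, 0 <= psi k) ->
  ('E_P[psi \o c] = (\sum_k cell_prob k * psi k)%:E)%E.
Proof.
move=> psi0; rewrite unlock integral_cells //; last 2 first.
- by apply/measurable_EFinP; exact: measurable_cell_fun.
- by move=> x; rewrite lee_fin /= psi0.
rewrite -sumEFin; apply: eq_bigr => k _.
rewrite (eq_integral (fun=> (psi k)%:E)); last first.
  by move=> x; rewrite inE /= => ->.
by rewrite integral_cst //= cell_probE -EFinM mulrC.
Qed.

Lemma cell_prob_sum1 : \sum_k cell_prob k = 1.
Proof.
have := @expectation_cells (fun=> 1) (fun=> ler01).
rewrite (_ : _ \o _ = cst 1) // expectation_cst => -[->].
by apply: eq_bigr => k _; rewrite mulr1.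
Qed.

End finite_partition.

Section uniform.
Context (R : realType).

Lemma uniform_prob_itv (a b : R) : 0 <= a -> a <= b -> b <= 1 ->
  uniform_prob (@ltr01 R) `]a, b] = (b - a)%:E.
Proof.
move=> a0 ab b1; rewrite /uniform_prob.
rewrite (eq_integral (fun=> 1%E)); last first.
  move=> x; rewrite inE /= in_itv /= => /andP[ax xb].
  rewrite /uniform_pdf ifT ?subr0 ?invr1 //; apply/andP; split; lra.
rewrite integral_cst //= mul1e lebesgue_measure_itv /= lte_fin.
move: ab; rewrite le_eqVlt => /predU1P[->|ab]; first by rewrite ltxx subrr.
by rewrite ab EFinB.
Qed.

End uniform.

Section bins.
Context (R : realType) (d kappa : nat).
Local Notation point := (point R d).
Local Notation cube := (@unit_cube R d).
Local Notation leb := (lebesgue_cube R d).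
Local Notation bins := (d.-tuple 'I_kappa).
Implicit Types (k : bins) (x : point).

Definition bin_of x : option bins := [pick k | in_bin k x].

Lemma in_binP k x : reflect (forall l, (tnth k l)%:R / kappa%:R < coord x l <=
  (tnth k l).+1%:R / kappa%:R) (in_bin k x).
Proof. exact: forallP. Qed.

Lemma ord_kappa_gt0 (i : 'I_kappa) : 0 < kappa%:R :> R.
Proof. by rewrite ltr0n (leq_trans _ (ltn_ord i)). Qed.

Lemma in_bin_inj k k' x : in_bin k x -> in_bin k' x -> k = k'.
Proof.
move=> /in_binP kx /in_binP k'x; apply: eq_from_tnth => l; apply: val_inj => /=.
have k0 := ord_kappa_gt0 (tnth k l).
have /andP[h1 h2] := kx l; have /andP[h3 h4] := k'x l.
apply/eqP; rewrite eqn_leq; apply/andP; split; rewrite -ltnS -(ltr_nat R).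
  by rewrite -(ltr_pM2r (_ : 0 < kappa%:R^-1)) ?invr_gt0 // (lt_le_trans h1).
by rewrite -(ltr_pM2r (_ : 0 < kappa%:R^-1)) ?invr_gt0 // (lt_le_trans h3).
Qed.

Lemma bin_of_eq x k : (bin_of x == Some k) = in_bin k x.
Proof.
rewrite /bin_of; case: pickP => [k' k'x|/(_ k) ->] //=.
apply/eqP/idP => [[<-//]|kx]; by rewrite (in_bin_inj k'x kx).
Qed.

Definition bin_set k : set point := bin_of @^-1` [set Some k].

Lemma bin_setE k : bin_set k = [set x | in_bin k x].
Proof.
by apply/seteqP; split => x; rewrite /bin_set /= -bin_of_eq => /eqP.
Qed.

Definition bin_side k (l : 'I_d) : set (measurableTypeR R) :=
  `](tnth k l)%:R / kappa%:R, (tnth k l).+1%:R / kappa%:R].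

Lemma bin_set_box k : bin_set k = box (bin_side k).
Proof.
rewrite bin_setE; apply/seteqP; split => x /=.
  by move=> /in_binP kx l; rewrite /bin_side /= in_itv /=; exact: kx.
by move=> kx; apply/in_binP => l; have := kx l; rewrite /bin_side /= in_itv.
Qed.

Lemma measurable_bin_set k : measurable (bin_set k).
Proof. by rewrite bin_set_box; apply: measurable_box => l; exact: measurable_itv. Qed.

Lemma measurable_bin_fiber (o : option bins) : measurable (bin_of @^-1` [set o]).
Proof.
case: o => [k|]; first exact: measurable_bin_set.
rewrite (_ : _ @^-1` _ = ~` \bigcup_(k in [set: bins]) bin_set k).
  apply: measurableC; apply: fin_bigcup_measurable => [|k _].
    exact: finite_finset.
  exact: measurable_bin_set.
apply/seteqP; split => x /=; first by move=> xN [k _]; rewrite /bin_set /= xN.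
by move=> H; case E : (bin_of x) => [k|//]; case: H; exists k.
Qed.

Lemma bin_set_sub_cube k : bin_set k `<=` cube.
Proof.
rewrite bin_setE => x /= /in_binP kx l; have k0 := ord_kappa_gt0 (tnth k l).
have /andP[h1 h2] := kx l; apply/andP; split.
  by apply: ltW; apply: le_lt_trans h1; rewrite divr_ge0 // ltW.
by apply: (le_trans h2); rewrite ler_pdivrMr // mul1r ler_nat.
Qed.

Definition bin_vol : R := kappa%:R^-1 ^+ d.

Lemma lebesgue_bin k : leb (bin_set k) = bin_vol%:E.
Proof.
rewrite bin_set_box /lebesgue_cube iid_box; last by move=> l; exact: measurable_itv.
rewrite (eq_bigr (fun=> (kappa%:R^-1)%:E)) => [|l _].
  by rewrite prodEFin prodr_const card_ord.
have k0 := ord_kappa_gt0 (tnth k l).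
have -> : (kappa%:R^-1 : R) = (tnth k l).+1%:R / kappa%:R - (tnth k l)%:R / kappa%:R.
  by rewrite -mulrBl -natr1 addrAC subrr add0r mul1r.
apply: uniform_prob_itv.
- by rewrite divr_ge0 // ltW.
- by rewrite ler_pM2r ?invr_gt0 // ler_nat.
- by rewrite ler_pdivrMr // mul1r ler_nat.
Qed.

Hypothesis kappa_gt0 : (0 < kappa)%N.

(** The kappa ^ d bins, of volume kappa ^ -d each, already have total mass 1; the
    faces of the cube that they miss are null. *)
Lemma lebesgue_outside_bins : leb (bin_of @^-1` [set None]) = 0%E.
Proof.
rewrite (cell_probE leb measurable_bin_fiber); congr (_%:E).
have := cell_prob_sum1 leb measurable_bin_fiber.
rewrite (bigD1 None) //= (reindex_omap Some id) //=; last by case.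
rewrite (eq_bigr (fun=> bin_vol)); last first.
  by move=> k _; apply: EFin_inj; rewrite -cell_probE ?lebesgue_bin //; exact: measurable_bin_fiber.
rewrite (eq_bigl xpredT) => [|k]; last by rewrite eqxx.
rewrite sumr_const card_tuple card_ord -mulr_natr natrX -exprMn mulVf ?expr1n.
  by move=> h; apply: (addIr 1); rewrite add0r -[RHS]h.
by rewrite pnatr_eq0 -lt0n.
Qed.

End bins.

(** * Densities and the laws that they induce on the bins *)

Section bin_laws.
Context (R : realType) (d kappa : nat).
Local Notation point := (point R d).
Local Notation cube := (@unit_cube R d).
Local Notation leb := (lebesgue_cube R d).
Local Notation bins := (d.-tuple 'I_kappa).
Local Notation bset := (@bin_set R d kappa).
Hypothesis kappa_gt0 : (0 < kappa)%N.
Implicit Types (f g : density R d) (k : bins).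

Definition bin_law f : option bins -> R := cell_prob (law f) (@bin_of R d kappa).

Lemma bin_law_ge0 f o : 0 <= bin_law f o.
Proof. exact: cell_prob_ge0. Qed.

Lemma bin_law_sum1 f : \sum_o bin_law f o = 1.
Proof. exact: (cell_prob_sum1 (law f) (@measurable_bin_fiber R d kappa)). Qed.

Lemma measurable_density_on f A : measurable A -> A `<=` cube ->
  measurable_fun A (fun x => (f x)%:E).
Proof.
move=> mA Acube; apply/measurable_EFinP.
apply: measurable_funS Acube _; first exact: measurable_unit_cube.
exact: measurable_density.
Qed.

Lemma bin_lawE f k : (\int[leb]_(x in bset k) (f x)%:E = (bin_law f (Some k))%:E)%E.
Proof.
rewrite /bin_law -cell_probE; last exact: measurable_bin_fiber.
by rewrite /= /law setIidl //; exact: bin_set_sub_cube.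
Qed.

Lemma bin_law_None f : bin_law f None = 0.
Proof.
apply: EFin_inj; rewrite /bin_law -cell_probE; last exact: measurable_bin_fiber.
have mN : measurable ((@bin_of R d kappa) @^-1` [set None] `&` cube).
  apply: measurableI; [exact: measurable_bin_fiber|exact: measurable_unit_cube].
rewrite /= /law; apply: null_set_integral => //.
  by apply: measurable_density_on => //; exact: subIsetr.
apply/eqP; rewrite -measure_le0 -(lebesgue_outside_bins R d kappa_gt0).
by apply: le_measure; rewrite ?inE //; exact: measurable_bin_fiber.
Qed.

(** This is how a pointwise lower bound on f - g over a bin reaches the drift;
    c >= 0 keeps all integrands nonnegative. *)
Lemma bin_law_shift f g k c : 0 <= c ->
  (forall x, in_bin k x -> g x + c <= f x) ->
  bin_law g (Some k) + c * bin_vol R d kappa <= bin_law f (Some k).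
Proof.
move=> c0 gf; rewrite -lee_fin EFinD -!bin_lawE.
have mk : measurable (bset k) by exact: measurable_bin_set.
have -> : (c * bin_vol R d kappa)%:E = (\int[leb]_(x in bset k) (cst c%:E) x)%E.
  by rewrite integral_cst // EFinM -(lebesgue_bin R k).
have g0 (h : density R d) x : bset k x -> (0 <= (h x)%:E)%E.
  by move=> /bin_set_sub_cube cx; rewrite lee_fin density_ge0.
have mh (h : density R d) : measurable_fun (bset k) (fun x => (h x)%:E).
  by apply: measurable_density_on mk _; exact: bin_set_sub_cube.
rewrite -ge0_integralD //.
- apply: ge0_le_integral => //.
  + by move=> x kx; rewrite adde_ge0 ?g0 //= lee_fin.
  + by apply: emeasurable_funD => //; exact: mh.
  + by move=> x; rewrite bin_setE => /gf; rewrite -EFinD lee_fin.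
- by move=> x; exact: g0.
Qed.

Lemma bin_law_le f L : 0 <= L -> (forall x, cube x -> f x <= L) ->
  forall k, bin_law f (Some k) <= L * bin_vol R d kappa.
Proof.
move=> L0 fL k; rewrite -lee_fin -bin_lawE.
have mk : measurable (bset k) by exact: measurable_bin_set.
have -> : (L * bin_vol R d kappa)%:E = (\int[leb]_(x in bset k) (cst L%:E) x)%E.
  by rewrite integral_cst // EFinM -(lebesgue_bin R k).
apply: ge0_le_integral => //.
- by move=> x /bin_set_sub_cube cx; rewrite lee_fin density_ge0.
- exact: measurable_density_on mk (@bin_set_sub_cube R d kappa k).
- by move=> x /bin_set_sub_cube cx; rewrite lee_fin fL.
Qed.

(** The L2 distance is computed bin by bin, the complement of the bins being
    null. *)
Lemma l2_dist_le_bins f g (H : bins -> R) eps : 0 <= eps ->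
  (forall k, 0 <= H k) ->
  (forall k x, in_bin k x -> (f x - g x) ^+ 2 <= H k) ->
  (eps%:E <= l2_dist f g)%E ->
  eps ^+ 2 <= bin_vol R d kappa * \sum_k H k.
Proof.
move=> eps0 H0 fgH.
pose F := (fun x : point => ((f x - g x) ^+ 2)%:E).
have mF A : measurable A -> A `<=` cube -> measurable_fun A F.
  move=> mA Ac; apply/measurable_EFinP; apply: measurable_funX.
  by apply: measurable_funB; apply/measurable_EFinP; exact: measurable_density_on.
have F0 x : (0 <= F x)%E by rewrite lee_fin sqr_ge0.
have mcube : measurable cube by exact: measurable_unit_cube.
have IF : (\int[leb]_(x in cube) F x <= (bin_vol R d kappa * \sum_k H k)%:E)%E.
  rewrite integral_mkcond (integral_cells leb (@measurable_bin_fiber R d kappa)); last 2 first.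
  - by apply/(measurable_restrictT _ mcube); exact: mF.
  - by move=> x; rewrite erestrict_ge0.
  rewrite (bigD1 None) //= null_set_integral; last 3 first.
  - exact: measurable_bin_fiber.
  - apply: measurable_funTS; apply/(measurable_restrictT _ mcube); exact: mF.
  - exact: lebesgue_outside_bins.
  rewrite add0e (reindex_omap Some id) //=; last by case.
  rewrite (eq_bigl xpredT) => [|k]; last by rewrite eqxx.
  rewrite mulr_sumr -sumEFin; apply: lee_sum => k _.
  have mk : measurable (bset k) by exact: measurable_bin_set.
  rewrite -/(bset k) mulrC EFinM -(lebesgue_bin R k) -integral_cst //.
  apply: ge0_le_integral => //.
  - by move=> x _; rewrite erestrict_ge0.
  - by apply: measurable_funTS; apply/(measurable_restrictT _ mcube); exact: mF.
  - move=> x kx; rewrite patchE mem_set; last exact: bin_set_sub_cube kx.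
    by move: kx; rewrite bin_setE lee_fin => /fgH.
rewrite /l2_dist -/F => epsF.
have IF0 : (0 <= \int[leb]_(x in cube) F x)%E by exact: integral_ge0.
have Ifin : (\int[leb]_(x in cube) F x)%E \is a fin_num.
  by rewrite ge0_fin_numE // (le_lt_trans IF) // ltry.
rewrite -lee_fin (le_trans _ IF) //.
move: epsF IF0; rewrite -(fineK Ifin); set I := fine _ => epsF.
rewrite poweR_EFin lee_fin in epsF; rewrite !lee_fin => I0.
rewrite powR12_sqrt // in epsF.
by rewrite -(sqr_sqrtr I0) lerXn2r // nnegrE sqrtr_ge0.
Qed.

End bin_laws.

(** * Oscillation of a difference of Hoelder densities over a bin *)

Lemma grid_step_exists (R : realFieldType) (delta y : R) (a b : nat) : (a < b)%N ->
  a%:R * delta < y <= b%:R * delta ->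
  exists2 n, (a <= n < b)%N & n%:R * delta < y <= n.+1%:R * delta.
Proof.
move=> ab /andP[ay]; elim: b ab => [//|b IH]; rewrite ltnS leq_eqVlt.
case/predU1P => [<-|ab] yb; first by exists a; rewrite ?leqnn ?ltnSn ?ay.
have [yb'|yb'] := lerP y (b%:R * delta).
  have [n /andP[an nb] H] := IH ab yb'; exists n => //.
  by rewrite an (leq_trans nb).
by exists b; rewrite ?yb' ?yb // (ltnW ab) ltnSn.
Qed.

(** A block is a cube of q ^ d bins, with lowest corner c / kappa. It is q times
    wider than a bin, which leaves room for the polynomial approximation: the
    oscillation over one bin is a small multiple 2 A d / q of the sup norm over the
    block, up to an error of order kappa ^ (- s). *)
Section block_oscillation.
Context (R : realType) (d kappa q : nat) (s L A : R) (f g : density R d).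
Local Notation point := (point R d).
Local Notation cube := (@unit_cube R d).
Local Notation bins := (d.-tuple 'I_kappa).
Hypothesis kappa_gt0 : (0 < kappa)%N.
Hypothesis q_ge2 : (2 <= q)%N.
Hypothesis s_gt0 : 0 < s.
Hypothesis L_ge0 : 0 <= L.
Hypothesis A_gt0 : 0 < A.
Hypothesis polyA : increment_const (strict_floor s) A.
Hypothesis fH : hoelder_class s L f.
Hypothesis gH : hoelder_class s L g.
Variable c : 'I_d -> nat.
Hypothesis c_le : forall l, (c l + q <= kappa)%N.

Let delta : R := kappa%:R^-1.
Let h (x : point) : R := f x - g x.
Let tau := q%:R * delta / 2.

Definition block (x : point) :=
  forall l, (c l)%:R * delta < coord x l <= (c l + q)%:R * delta.

Let kappaR : 0 < kappa%:R :> R. Proof. by rewrite ltr0n. Qed.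

Let delta_gt0 : 0 < delta. Proof. by rewrite invr_gt0. Qed.

Let qR : 2 <= q%:R :> R. Proof. by rewrite ler_nat. Qed.

Let tau_gt0 : 0 < tau.
Proof. by rewrite divr_gt0 // mulr_gt0 // (lt_le_trans _ qR). Qed.

Let delta_le_tau : delta <= tau.
Proof. by rewrite /tau mulrAC ler_peMl ?(ltW delta_gt0) // ler_pdivlMr // mul1r. Qed.

Lemma block_sub_cube x : block x -> cube x.
Proof.
move=> cx l; have /andP[h1 h2] := cx l; apply/andP; split.
  by rewrite (le_trans _ (ltW h1)) // mulr_ge0 // ltW.
by rewrite (le_trans h2) // ler_pdivrMr // mul1r ler_nat.
Qed.

Lemma axis_shift0 (x : point) l : axis_shift x l 0 = x.
Proof.
by apply: eq_from_tnth => i; rewrite tnth_mktuple addr0 if_same.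
Qed.

Definition oscillation_bound M := A * (2 / q%:R) * (M + 2 * L * tau `^ s) + 2 * L * delta `^ s.

Variable M : R.
Hypothesis hM : forall x, block x -> `|h x| <= M.

Lemma ray_oscillation x l sigma t : `|sigma| = 1 ->
  (forall u, 0 <= u <= tau -> block (axis_shift x l (sigma * u))) ->
  0 <= t <= delta -> `|h (axis_shift x l (sigma * t)) - h x| <= oscillation_bound M.
Proof.
move=> sigma1 xc /andP[t0 td].
have xcube u : 0 <= u <= tau -> cube (axis_shift x l (sigma * u)).
  by move=> u01; apply: block_sub_cube; exact: xc.
have [P sP fP] := hoelder_axis_poly s_gt0 fH sigma1 tau_gt0 xcube.
have [Q sQ gQ] := hoelder_axis_poly s_gt0 gH sigma1 tau_gt0 xcube.
have tt : 0 <= t <= tau by rewrite t0 (le_trans td).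
have B0 : 0 <= 2 * L by rewrite mulr_ge0.
have sPQ : (size (P - Q)%R <= (strict_floor s).+1)%N.
  by rewrite (leq_trans (size_polyD _ _)) // size_polyN geq_max sP sQ.
have hPQ u : 0 <= u <= tau ->
    `|h (axis_shift x l (sigma * u)) - (P - Q).[u]| <= 2 * L * u `^ s.
  move=> u01; rewrite hornerD hornerN /h.
  have := fP u u01; have := gQ u u01; rewrite !ler_norml; lra.
have hMu u : 0 <= u <= tau -> `|h (axis_shift x l (sigma * u))| <= M.
  by move=> u01; apply: hM; exact: xc.
have := near_poly_oscillation polyA tau_gt0 s_gt0 B0 sPQ hPQ hMu tt.
rewrite mulr0 axis_shift0 => /le_trans; apply.
have M0 : 0 <= M + 2 * L * tau `^ s.
  rewrite addr_ge0 ?mulr_ge0 ?powR_ge0 //.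
  by have := hMu t tt; apply: le_trans.
rewrite /oscillation_bound lerD //.
  rewrite ler_wpM2r // ler_wpM2l ?(ltW A_gt0) // ler_pdivrMr // /tau.
  rewrite (le_trans td) // le_eqVlt; apply/orP; left; apply/eqP; field.
  by rewrite gt_eqF // (lt_le_trans _ qR).
rewrite ler_wpM2l //; apply: ge0_ler_powR; rewrite ?nnegrE ?(ltW s_gt0) //.
exact: le_trans td.
Qed.

(** One of the two ends of the segment can move by tau, half the width of the
    block, towards the other end and beyond without leaving the block; this end
    is the base point of the ray. *)
Lemma axis_oscillation x l t : block x -> block (axis_shift x l t) -> 0 <= t <= delta ->
  `|h (axis_shift x l t) - h x| <= oscillation_bound M.
Proof.
move=> cx cxt t01; have /andP[t0 td] := t01.
have [xm|xm] := lerP (coord x l) ((c l)%:R * delta + tau).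
  have := @ray_oscillation x l 1 t (normr1 _) _ t01; rewrite !mul1r; apply.
  move=> u /andP[u0 ut] i; rewrite mul1r coord_axis_shift.
  case: eqP => [->|_]; last exact: cx.
  have := cx l; rewrite natrD mulrDl (_ : q%:R * delta = 2 * tau); last by rewrite /tau; field.
  by move: delta_gt0; lra.
have E : axis_shift (axis_shift x l t) l (-1 * t) = x.
  apply: eq_from_tnth => i; rewrite tnth_mktuple coord_axis_shift.
  by case: eqP => // _; rewrite mulN1r addrK.
have := @ray_oscillation (axis_shift x l t) l (-1) t _ _ t01.
rewrite E distrC normrN1; apply=> // u /andP[u0 ut] i; rewrite mulN1r.
have := cxt i; rewrite !coord_axis_shift.
case: eqP => [->|//]; rewrite natrD mulrDl.
rewrite (_ : q%:R * delta = 2 * tau); last by rewrite /tau; field.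
lra.
Qed.

Lemma coordinate_oscillation x y l : block x -> block y ->
  (forall i, i != l -> coord y i = coord x i) ->
  `|coord y l - coord x l| <= delta -> `|h y - h x| <= oscillation_bound M.
Proof.
wlog xy : x y / coord x l <= coord y l.
  move=> W cx cy xy_eq xyd; have [xy|/ltW yx] := leP (coord x l) (coord y l); first exact: W.
  rewrite distrC; apply: W => //; last by rewrite distrC.
  by move=> i il; rewrite xy_eq.
move=> cx cy xy_eq; rewrite ger0_norm ?subr_ge0 // => xyd.
have E : y = axis_shift x l (coord y l - coord x l).
  apply: eq_from_tnth => i; rewrite tnth_mktuple.
  case: eqP => [->|/eqP /xy_eq //].
  by rewrite addrC subrK.
by rewrite E; apply: axis_oscillation; rewrite -?E // subr_ge0 xy.
Qed.

Definition bin_in_block (k : bins) := forall l, (c l <= tnth k l < c l + q)%N.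

Lemma in_bin_block k x : bin_in_block k -> in_bin k x -> block x.
Proof.
move=> kc /in_binP kx l; have /andP[ck kq] := kc l; have /andP[h1 h2] := kx l.
apply/andP; split.
  by apply: le_lt_trans h1; rewrite ler_wpM2r ?(ltW delta_gt0) // ler_nat.
by apply: (le_trans h2); rewrite ler_wpM2r ?(ltW delta_gt0) // ler_nat.
Qed.

Lemma block_bin x : block x -> exists2 k, bin_in_block k & in_bin k x.
Proof.
move=> cx.
have : forall l, exists i : 'I_kappa, (c l <= i < c l + q)%N /\
    i%:R * delta < coord x l <= i.+1%:R * delta.
  move=> l; have [|n ncq nx] := @grid_step_exists _ delta (coord x l) (c l) (c l + q) _ (cx l).
    by rewrite -[X in (X < _)%N]addn0 ltn_add2l (leq_trans _ q_ge2).
  have nk : (n < kappa)%N by rewrite (leq_trans _ (c_le l)) //; case/andP: ncq.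
  by exists (Ordinal nk).
move=> /fin_all_exists[k kP]; exists [tuple k l | l < d].
  by move=> l; rewrite tnth_mktuple; have [] := kP l.
by apply/in_binP => l; rewrite tnth_mktuple; have [] := kP l.
Qed.

(** Two points of a bin are joined by d moves along the axes inside the bin. *)
Lemma bin_oscillation k x y : bin_in_block k -> in_bin k x -> in_bin k y ->
  `|h y - h x| <= d%:R * oscillation_bound M.
Proof.
move=> kc kx ky.
pose mix j : point := [tuple if (i < j)%N then coord y i else coord x i | i < d].
have mixE j i : coord (mix j) i = if (i < j)%N then coord y i else coord x i.
  by rewrite /coord tnth_mktuple.
have kmix j : in_bin k (mix j).
  apply/in_binP => i; rewrite mixE; case: ifP => _.
    by move/in_binP : ky.
  by move/in_binP : kx.
have cmix j : block (mix j) by exact: in_bin_block kc (kmix j).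
have mix0 : mix 0%N = x by apply: eq_from_tnth => i; rewrite tnth_mktuple.
have mixd : mix d = y by apply: eq_from_tnth => i; rewrite tnth_mktuple ltn_ord.
have step j : (j <= d)%N -> `|h (mix j) - h x| <= j%:R * oscillation_bound M.
  elim: j => [|j IH] jd; first by rewrite mix0 subrr normr0 mul0r.
  rewrite -(subrK (h (mix j)) (h (mix j.+1))) -addrA (le_trans (ler_normD _ _)) //.
  rewrite -natr1 mulrDl mul1r [leRHS]addrC lerD //; last exact: IH (ltnW jd).
  apply: (@coordinate_oscillation _ _ (Ordinal jd)) => //.
    by move=> i; rewrite -val_eqE /= !mixE ltnS leq_eqVlt => /negbTE ->.
  rewrite !mixE /= ltnSn ltnn.
  move/in_binP : kx => /(_ (Ordinal jd)); move/in_binP : ky => /(_ (Ordinal jd)).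
  by rewrite -/delta -natr1 mulrDl mul1r ler_norml; lra.
by have := step d (leqnn d); rewrite mixd.
Qed.

Let drift k := bin_drift (@bin_law R d kappa f) (@bin_law R d kappa g) k.

(** The difference f - g keeps its sign on the bin as soon as its value at x
    exceeds the oscillation, so no cancellation occurs in the drift. *)
Lemma bin_mean_bound k x : bin_in_block k -> in_bin k x ->
  (`|h x| - d%:R * oscillation_bound M) * bin_vol R d kappa <= `|drift k|.
Proof.
move=> kc kx; set e := d%:R * _.
have vol0 : 0 <= bin_vol R d kappa by rewrite exprn_ge0 // invr_ge0 ltW.
have osc y : in_bin k y -> `|h y - h x| <= e by move=> ky; apply: bin_oscillation ky.
have [|he] := lerP (`|h x| - e) 0.
  by move=> he; rewrite (le_trans _ (normr_ge0 _)) // mulr_le0_ge0.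
have [hx|hx] := lerP 0 (h x).
  rewrite (ger0_norm hx) in he *.
  have := @bin_law_shift R d kappa f g k (h x - e) (ltW he).
  rewrite -lerBrDl -/(bin_drift _ _ k) -/(drift k) => H.
  apply: le_trans (ler_norm _); apply: H => y /osc; rewrite /h ler_norml; lra.
rewrite (ltr0_norm hx) in he *.
have := @bin_law_shift R d kappa g f k (- h x - e) (ltW he).
rewrite -lerBrDl => H; rewrite /drift /bin_drift distrC.
by apply: le_trans (ler_norm _); apply: H => y /osc; rewrite /h ler_norml; lra.
Qed.

End block_oscillation.

(** * The smoothing bias *)

Section near_bins.
Context (d kappa q : nat).
Local Notation bins := (d.-tuple 'I_kappa).

(** The block attached to a bin starts at the bin itself, unless it would stick
    out of the cube, in which case it is pushed back. *)
Definition block_start (k : bins) (l : 'I_d) : nat := minn (tnth k l) (kappa - q).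

Definition near_bin (k k' : bins) : bool :=
  [forall l, block_start k l <= tnth k' l < block_start k l + q]%N.

(** The coordinates of k and k' differ by less than q, so the shifted differences
    encode k injectively. *)
Lemma card_near_bin (k' : bins) : (0 < q)%N -> (q <= kappa)%N ->
  (#|[pred k | near_bin k k']| <= (2 * q) ^ d)%N.
Proof.
move=> q0 qk; pose Q := (2 * q).-1; have QE : Q.+1 = (2 * q)%N by rewrite /Q; lia.
pose F (k : bins) : d.-tuple 'I_Q.+1 := [tuple inord (tnth k l + q - tnth k' l) | l < d].
have bounds k l : near_bin k k' -> (tnth k l < tnth k' l + q)%N /\ (tnth k' l < tnth k l + q)%N.
  move=> /forallP /(_ l); rewrite /block_start; have := ltn_ord (tnth k l); lia.
have Finj : {in [pred k | near_bin k k'] &, injective F}.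
  move=> k1 k2; rewrite !inE => n1 n2 E; apply: eq_from_tnth => l; apply: val_inj => /=.
  have [a1 b1] := bounds k1 l n1; have [a2 b2] := bounds k2 l n2.
  have := congr1 (fun t => val (tnth t l)) E; rewrite !tnth_mktuple /= !inordK; lia.
rewrite -(card_in_image Finj) -QE -[X in (_ <= X ^ _)%N]card_ord -card_tuple.
exact: max_card.
Qed.

End near_bins.

Section bias.
Context (R : realType) (d kappa q : nat) (s L A : R) (f g : density R d).
Local Notation point := (point R d).
Local Notation bins := (d.-tuple 'I_kappa).
Hypothesis kappa_gt0 : (0 < kappa)%N.
Hypothesis q_ge2 : (2 <= q)%N.
Hypothesis s_gt0 : 0 < s.
Hypothesis L_ge0 : 0 <= L.
Hypothesis A_gt0 : 0 < A.
Hypothesis polyA : increment_const (strict_floor s) A.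
Hypothesis fH : hoelder_class s L f.
Hypothesis gH : hoelder_class s L g.
Hypothesis q_large : 4 * A * d%:R <= q%:R.

Let delta : R := kappa%:R^-1.
Let drift := bin_drift (@bin_law R d kappa f) (@bin_law R d kappa g).
Let vol := bin_vol R d kappa.

Definition bias_const : R := 2 * L * (q%:R / 2) `^ s + 4 * d%:R * L.

Let kappaR : 0 < kappa%:R :> R. Proof. by rewrite ltr0n. Qed.

Let delta_gt0 : 0 < delta. Proof. by rewrite invr_gt0. Qed.

Let qR : 0 < q%:R :> R. Proof. by rewrite ltr0n (leq_trans _ q_ge2). Qed.

Let vol_gt0 : 0 < vol. Proof. by rewrite exprn_gt0. Qed.

Lemma hoelder_diff_le x : unit_cube x -> `|f x - g x| <= 2 * L.
Proof.
move=> x01; have := hoelder_bounded fH x01; have := hoelder_bounded gH x01.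
by rewrite !ler_norml; lra.
Qed.

(** The supremum M of |f - g| over the block is at most the largest bin average
    plus d times the oscillation bound; the latter contains M with a factor at
    most 1 / 2, which is absorbed on the left. *)
Lemma block_sup_bound c H : (forall l, (c l + q <= kappa)%N) ->
  (forall k : bins, bin_in_block q c k -> `|drift k| <= H * vol) ->
  forall x, block kappa q c x -> `|f x - g x| <= 2 * H + bias_const * delta `^ s.
Proof.
move=> c_le driftH x cx.
pose S := [set `|f y - g y| | y in [set y | block kappa q c y]].
have Sx : S `|f x - g x| by exists x.
have supS : has_sup S.
  split; first by exists `|f x - g x|.
  exists (2 * L) => _ [y cy <-]; apply: hoelder_diff_le; exact: block_sub_cube cy.
pose M := sup S.
have hM y : block kappa q c y -> `|f y - g y| <= M.
  by move=> cy; apply: sup_upper_bound => //; exists y.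
pose osc := d%:R * oscillation_bound kappa q s L A M.
have MH : M <= H + osc.
  apply: ge_sup; first by exists `|f x - g x|.
  move=> _ [y cy <-]; have [k kc ky] := block_bin q_ge2 c_le cy.
  have := bin_mean_bound kappa_gt0 q_ge2 s_gt0 L_ge0 A_gt0 polyA fH gH c_le hM kc ky.
  move=> /le_trans /(_ (driftH k kc)).
  by rewrite ler_pM2r // lerBlDr.
have tauE : (q%:R * delta / 2) `^ s = (q%:R / 2) `^ s * delta `^ s.
  by rewrite -powRM ?divr_ge0 ?(ltW delta_gt0) // mulrAC.
have M0 : 0 <= M by apply: le_trans (hM x cx).
have q0 : 0 <= (q%:R / 2) `^ s * delta `^ s by rewrite mulr_ge0 ?powR_ge0.
have dA : d%:R * (A * (2 / q%:R)) <= 2^-1.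
  by rewrite !mulrA ler_pdivrMr //; have := q_large; nra.
have : osc <= 2^-1 * (M + 2 * L * ((q%:R / 2) `^ s * delta `^ s)) + d%:R * (2 * L * delta `^ s).
  rewrite /osc /oscillation_bound -/delta tauE.
  set X := _ `^ s * _ in q0 *; set Y := M + _.
  have Y0 : 0 <= Y by rewrite addr_ge0 // mulr_ge0 // mulr_ge0.
  by rewrite mulrDr lerD // mulrA ler_wpM2r.
have := hM x cx; rewrite /bias_const; lra.
Qed.

(** The binned drift captures the L2 separation up to kappa ^ (- s), for any
    smoothness s: on each bin, |f - g| is at most twice the l2 norm of the bin
    averages over the attached block plus the bias, and each bin belongs to at
    most (2 q) ^ d attached blocks. For s <= 1 blocks of one bin would do; larger
    blocks are needed to exploit higher smoothness. *)
Lemma smoothing_bias eps : (q <= kappa)%N -> 0 <= eps -> (eps%:E <= l2_dist f g)%E ->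
  eps ^+ 2 <= 8 * (2 * q%:R) ^+ d * kappa%:R ^+ d *
     drift_sqr (@bin_law R d kappa f) (@bin_law R d kappa g) +
     2 * (bias_const * delta `^ s) ^+ 2.
Proof.
move=> qk eps0 eps_le.
set r := drift_sqr _ _; set b := bias_const * delta `^ s.
pose D (k : bins) := \sum_(k' | near_bin q k k') drift k' ^+ 2.
have D0 k : 0 <= D k by apply: sumr_ge0 => k' _; apply: sqr_ge0.
pose H (k : bins) := Num.sqrt (D k) / vol.
have c_le (k : bins) l : (block_start q k l + q <= kappa)%N by rewrite /block_start; lia.
have own (k : bins) : bin_in_block q (block_start q k) k.
  by move=> l; rewrite /block_start; have := ltn_ord (tnth k l); lia.
have fgH (k : bins) x : in_bin k x -> (f x - g x) ^+ 2 <= 8 * H k ^+ 2 + 2 * b ^+ 2.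
  move=> kx.
  have := @block_sup_bound (block_start q k) (H k) (c_le k) _ x _.
  have driftH k' : bin_in_block q (block_start q k) k' -> `|drift k'| <= H k * vol.
    move=> k'c; rewrite /H divfK ?gt_eqF // -sqrtr_sqr ler_wsqrtr //.
    rewrite /D (bigD1 k') /=; last by apply/forallP.
    by rewrite lerDl sumr_ge0 // => ? _; apply: sqr_ge0.
  move=> /(_ driftH (in_bin_block kappa_gt0 (own k) kx)); rewrite -/b => hle.
  rewrite -real_normK ?num_real // (@le_trans _ _ ((2 * H k + b) ^+ 2)) //.
    by rewrite lerXn2r // nnegrE // (le_trans _ hle).
  by have := sqr_ge0 (2 * H k - b); nra.
apply: le_trans (l2_dist_le_bins kappa_gt0 eps0 _ fgH eps_le) _.
  by move=> k; rewrite addr_ge0 // mulr_ge0 // sqr_ge0.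
rewrite -/vol big_split /= mulrDr lerD //; last first.
  rewrite sumr_const card_tuple card_ord -[X in vol * X]mulr_natr natrX mulrCA.
  rewrite -exprMn mulVf ?gt_eqF //.
  by rewrite expr1n mulr1.
have -> : vol * (\sum_k 8 * H k ^+ 2) = 8 * kappa%:R ^+ d * \sum_k D k.
  rewrite !mulr_sumr; apply: eq_bigr => k _.
  rewrite /H expr_div_n sqr_sqrtr // /vol /bin_vol exprVn; field.
  by rewrite expf_neq0 // gt_eqF.
rewrite -!mulrA ler_pM2l // mulrCA ler_pM2l ?exprn_gt0 //.
rewrite /D (exchange_big_dep xpredT) //= /r /drift_sqr mulr_sumr.
apply: ler_sum => k' _; rewrite sumr_const -[leLHS]mulr_natl ler_wpM2r ?sqr_ge0 //.
by rewrite -[2]/(2%:R) -natrM -natrX ler_nat card_near_bin // (leq_trans _ q_ge2).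
Qed.

End bias.

(** * Reduction of the sampling model to the bins *)

Lemma sum_tuple_cons (R : realFieldType) (K : finType) n (F : n.+1.-tuple K -> R) :
  \sum_u F u = \sum_x \sum_(u : n.-tuple K) F [tuple of x :: u].
Proof.
rewrite pair_bigA /= (reindex (fun xu : K * n.-tuple K => [tuple of xu.1 :: xu.2])) //.
exists (fun u => (thead u, [tuple of behead u])) => [[x u]|u] _ /=.
  by congr pair; apply: val_inj.
by rewrite [RHS]tuple_eta; apply: val_inj.
Qed.

(** Two independent samples of size n are one sample of n pairs. *)
Lemma sum_tuples_iid_mean (R : realFieldType) (B : finType) (p q : option B -> R) n F :
  \sum_(u : n.-tuple (option B)) \sum_(v : n.-tuple (option B))
    (\prod_(i < n) p (tnth u i)) * (\prod_(i < n) q (tnth v i)) * F (zip u v) =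
  iid_mean (pair_law p q) n F.
Proof.
elim: n F => [|n IH] F /=.
  rewrite (big_pred1 [tuple]) => [|u]; last by apply/esym/eqP; apply: val_inj; case: u => -[].
  rewrite (big_pred1 [tuple]) => [|u]; last by apply/esym/eqP; apply: val_inj; case: u => -[].
  by rewrite !big_ord0 !mul1r.
rewrite sum_tuple_cons; transitivity (\sum_x \sum_y pair_law p q (x, y) *
    iid_mean (pair_law p q) n (fun w => F ((x, y) :: w))); last first.
  by rewrite pair_bigA; apply: eq_bigr => -[].
apply: eq_bigr => x _.
under eq_bigr => u _ do rewrite sum_tuple_cons.
rewrite exchange_big; apply: eq_bigr => y _ /=.
rewrite -IH mulr_sumr; apply: eq_bigr => u _; rewrite mulr_sumr; apply: eq_bigr => v _.
have prod_cons (r : option B -> R) t (w : n.-tuple (option B)) :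
    \prod_(i < n.+1) r (tnth [tuple of t :: w] i) = r t * \prod_(i < n) r (tnth w i).
  by rewrite big_ord_recl; congr (_ * _); apply: eq_bigr => i _; rewrite tnthS.
by rewrite !prod_cons /pair_law /=; ring.
Qed.

Section discretization.
Context (R : realType) (d kappa m : nat).
Local Notation point := (point R d).
Local Notation sample := (m.-tuple point).
Local Notation K := (option (d.-tuple 'I_kappa)).
Local Notation bin := (@bin_of R d kappa).

Definition bin_sample (z : sample * sample) : m.-tuple K * m.-tuple K :=
  (map_tuple bin z.1, map_tuple bin z.2).

Lemma bin_sample_fiber uv : bin_sample @^-1` [set uv] =
  box (fun i => bin @^-1` [set tnth uv.1 i]) `*` box (fun i => bin @^-1` [set tnth uv.2 i]).
Proof.
apply/seteqP; split => [[X Y] /= <-|[X Y] /= [XE YE]] /=.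
  by split => i /=; rewrite tnth_map.
by case: uv XE YE => u v /= XE YE; congr pair; apply: eq_from_tnth => i;
  rewrite tnth_map; [exact: XE|exact: YE].
Qed.

Let mbox (u : m.-tuple K) : measurable (box (fun i => bin @^-1` [set tnth u i])).
Proof. by apply: measurable_box => i; exact: measurable_bin_fiber. Qed.

Lemma measurable_bin_sample_fiber uv : measurable (bin_sample @^-1` [set uv]).
Proof. by rewrite bin_sample_fiber; apply: measurableX; exact: mbox. Qed.

(** The fibers of the bin memberships of the two samples are products of boxes,
    whose probabilities factor. *)
Lemma two_sample_expectation_bins (f g : density R d) (F : seq (K * K) -> R) :
  (forall w, 0 <= F w) ->
  two_sample_expectation f g (fun z : sample * sample => F (zip (map bin z.1) (map bin z.2))) =
  (iid_mean (pair_law (@bin_law R d kappa f) (@bin_law R d kappa g)) m F)%:E.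
Proof.
move=> F0; rewrite /two_sample_expectation.
rewrite (_ : (fun z : sample * sample => _) =
  (fun uv : m.-tuple K * m.-tuple K => F (zip uv.1 uv.2)) \o bin_sample); last by [].
rewrite (expectation_cells _ measurable_bin_sample_fiber); last by move=> ?; exact: F0.
congr (_%:E); rewrite -sum_tuples_iid_mean pair_bigA /=.
apply: eq_bigr => uv _; congr (_ * _); apply: EFin_inj.
rewrite -cell_probE; last exact: measurable_bin_sample_fiber.
rewrite bin_sample_fiber EFinM -!prodEFin.
apply: etrans (product_measure1E _ _ (mbox _) (mbox _)) _; congr (_ * _)%E.
  apply: etrans (iid_box _ (fun i => measurable_bin_fiber _)) _.
  by apply: eq_bigr => i _; rewrite -cell_probE //; exact: measurable_bin_fiber.
apply: etrans (iid_box _ (fun i => measurable_bin_fiber _)) _.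
by apply: eq_bigr => i _; rewrite -cell_probE //; exact: measurable_bin_fiber.
Qed.

Lemma bin_countE (X : sample) (k : d.-tuple 'I_kappa) :
  (bin_count X k)%:R = \sum_(o <- map bin X) (o == Some k)%:R :> R.
Proof.
rewrite /bin_count big_map big_tuple -sum1_card natr_sum big_mkcond /=.
by apply: eq_bigr => i _; rewrite bin_of_eq inE; case: in_bin.
Qed.

Lemma chi2_statE (z : sample * sample) :
  chi2_stat kappa z = bin_chi2 R (zip (map bin z.1) (map bin z.2)).
Proof.
rewrite /chi2_stat /bin_chi2; apply: eq_bigr => k _; congr (_ ^+ 2).
rewrite !bin_countE.
have sz : size (map bin z.1) = size (map bin z.2) by rewrite !size_map !size_tuple.
rewrite /bin_diff sumrB; congr (_ - _).
  by rewrite -{1}(@unzip1_zip _ _ (map bin z.1) (map bin z.2)) ?sz // big_map.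
by rewrite -{1}(@unzip2_zip _ _ (map bin z.1) (map bin z.2)) ?sz // big_map.
Qed.

End discretization.

(** * Error probabilities of the chi-squared test at one scale *)

Section chi2_at_one_scale.
Context (R : realType) (d kappa m : nat).
Local Notation point := (point R d).
Local Notation sample := (m.-tuple point).
Local Notation chi2 := (@chi2_stat R d m kappa).
Hypothesis kappa_gt0 : (0 < kappa)%N.

Definition noise_level : R := kappa%:R `^ (- (d%:R / 2)).

Lemma noise_level_gt0 : 0 < noise_level.
Proof. by rewrite powR_gt0 // ltr0n. Qed.

Lemma noise_level_sqr : noise_level ^+ 2 = bin_vol R d kappa.
Proof.
rewrite /noise_level -powR_mulrn ?powR_ge0 // -powRrM /bin_vol exprVn.
by rewrite mulNr divfK // powR_invn.
Qed.

Lemma measurable_chi2_fun (F : R -> R) :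
  measurable_fun [set: sample * sample] (fun z => F (chi2 z)).
Proof.
rewrite (_ : (fun z => _) = (fun uv : m.-tuple (option (d.-tuple 'I_kappa)) *
    m.-tuple (option (d.-tuple 'I_kappa)) => F (bin_chi2 R (zip uv.1 uv.2)))
    \o @bin_sample R d kappa m).
  exact: (measurable_cell_fun (@measurable_bin_sample_fiber R d kappa m)).
by apply/funext => z; rewrite chi2_statE.
Qed.

Variable L : R.
Hypothesis L_ge0 : 0 <= L.

Lemma expectation_chi2 (f g : density R d) (F : R -> R) : (forall x, 0 <= F x) ->
  two_sample_expectation f g (fun z => F (chi2 z)) =
  (iid_mean (pair_law (@bin_law R d kappa f) (@bin_law R d kappa g)) m
     (fun w => F (bin_chi2 R w)))%:E.
Proof.
move=> F0; rewrite -two_sample_expectation_bins //.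
by congr two_sample_expectation; apply/funext => z; rewrite chi2_statE.
Qed.

Lemma false_alarm_le (f : density R d) (F : R -> R) a : 0 < a -> (0 < m)%N ->
  (forall x, unit_cube x -> f x <= L) ->
  (forall x, 0 <= F x <= (2 * m%:R + a * m%:R * noise_level <= x)%R%:R) ->
  (two_sample_expectation f f (fun z => F (chi2 z)) <= (32 * L / a ^+ 2)%:E)%E.
Proof.
move=> a0 m0 fL F01; have th0 := noise_level_gt0.
have F0 x : 0 <= F x by case/andP: (F01 x).
have mR : 0 < m%:R :> R by rewrite ltr0n.
have t0 : 0 < a * m%:R * noise_level by rewrite !mulr_gt0.
rewrite expectation_chi2 // lee_fin.
have p_ge0 := @bin_law_ge0 R d kappa f.
apply: le_trans (le_iid_mean (pair_law_ge0 p_ge0 p_ge0) (G := fun w =>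
  (2 * m%:R + a * m%:R * noise_level <= bin_chi2 R w)%R%:R) _) _.
  by move=> w _; case/andP: (F01 (bin_chi2 R w)).
have vol0 : 0 <= L * bin_vol R d kappa by rewrite mulr_ge0 // exprn_ge0 // invr_ge0.
apply: le_trans (chi2_upper_tail p_ge0 p_ge0 (bin_law_sum1 _ f) (bin_law_sum1 _ f)
  vol0 (bin_law_le L_ge0 fL) (bin_law_le L_ge0 fL) m _ t0) _ => //.
rewrite -noise_level_sqr le_eqVlt; apply/orP; left; apply/eqP; field.
by rewrite !gt_eqF.
Qed.

Lemma miss_le (f g : density R d) (F : R -> R) a : 0 < a -> 0 < L -> (1 < m)%N ->
  (forall x, unit_cube x -> f x <= L) -> (forall x, unit_cube x -> g x <= L) ->
  32 * a * noise_level <=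
    m%:R * drift_sqr (@bin_law R d kappa f) (@bin_law R d kappa g) ->
  (forall x, 0 <= F x <= (x <= 2 * m%:R + a * m%:R * noise_level)%R%:R) ->
  (two_sample_expectation f g (fun z => F (chi2 z)) <= (35 * L / a ^+ 2)%:E)%E.
Proof.
move=> a0 L0 m1 fL gL drift F01; have th0 := noise_level_gt0.
have F0 x : 0 <= F x by case/andP: (F01 x).
rewrite expectation_chi2 // lee_fin.
have p_ge0 := @bin_law_ge0 R d kappa f.
have q_ge0 := @bin_law_ge0 R d kappa g.
apply: le_trans (le_iid_mean (pair_law_ge0 p_ge0 q_ge0) (G := fun w =>
  (bin_chi2 R w <= 2 * m%:R + a * m%:R * noise_level)%R%:R) _) _.
  by move=> w _; case/andP: (F01 (bin_chi2 R w)).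
have vol0 : 0 <= L * bin_vol R d kappa by rewrite mulr_ge0 // exprn_ge0 // invr_ge0.
apply: (chi2_lower_tail p_ge0 q_ge0 (bin_law_sum1 _ f) (bin_law_sum1 _ g) vol0
  (bin_law_le L_ge0 fL) (bin_law_le L_ge0 gL)) => //.
- exact: bin_law_None.
- exact: bin_law_None.
- by rewrite noise_level_sqr.
- exact: ltnW.
Qed.

End chi2_at_one_scale.

(** * From separation in L2 to separation of the bin laws *)

Section detection.
Context (R : realType) (d : nat) (L : R).
Hypothesis L_gt0 : 0 < L.

Lemma l2_dist_hoelder_le s (f g : density R d) eps : hoelder_class s L f ->
  hoelder_class s L g -> 0 <= eps -> (eps%:E <= l2_dist f g)%E -> eps <= 2 * L.
Proof.
move=> fH gH eps0 eps_le.
have := @l2_dist_le_bins R d 1 (ltn0Sn 0) f g (fun=> (2 * L) ^+ 2) eps eps0 _ _ eps_le.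
rewrite sumr_const card_tuple card_ord exp1n mulr1n /bin_vol invr1 expr1n mul1r.
have L0 : 0 <= 2 * L by rewrite mulr_ge0 // ltW.
move=> h; rewrite -(ler_pXn2r (_ : (0 < 2)%N)) ?nnegrE //; apply: h => [k|k x kx].
  exact: sqr_ge0.
rewrite -real_normK ?num_real // lerXn2r ?nnegrE //.
apply: (hoelder_diff_le fH gH); apply: (@bin_set_sub_cube R d 1 k).
by rewrite bin_setE.
Qed.

Definition resolution (s : R) m : R := m%:R `^ (2 / (4 * s + d%:R)).

Lemma resolution_rate s m : 0 < s ->
  m%:R `^ (- (2 * s / (4 * s + d%:R))) = resolution s m `^ (- s).
Proof.
move=> s0; rewrite /resolution -powRrM; congr (_ `^ _); field.
by rewrite gt_eqF // ltr_wpDr // mulr_gt0.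
Qed.

(** This equation determines the resolution n: a drift of squared size
    n ^ (- d) n ^ (- 2 s), which a separation n ^ (- s) leaves on n ^ d bins, is of
    the order n ^ (- d / 2) / m of the noise. *)
Lemma resolution_balance s m : 0 < s -> (0 < m)%N ->
  m%:R * (resolution s m `^ (- s)) ^+ 2 = resolution s m `^ (d%:R / 2).
Proof.
move=> s0 m0; have mR : 0 < m%:R :> R by rewrite ltr0n.
have D0 : 4 * s + d%:R != 0 by rewrite gt_eqF // ltr_wpDr // mulr_gt0.
rewrite /resolution -powR_mulrn ?powR_ge0 // -!powRrM -{1}[m%:R]powRr1 ?(ltW mR) //.
rewrite -powRD; last by rewrite (gt_eqF mR) implybT.
congr (_ `^ _); field; exact: D0.
Qed.

(** The separation constant C suffices at smoothness s, for every scale between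
    half the resolution and the resolution; this leeway lets the same constant
    serve the integer part of the resolution and its dyadic approximation. *)
Definition detects (s C : R) :=
  forall (m : nat) (a eps : R) (f g : density R d), (0 < m)%N -> 2^-1 <= a ->
  hoelder_class s L f -> hoelder_class s L g ->
  C * a * m%:R `^ (- (2 * s / (4 * s + d%:R))) <= eps -> (eps%:E <= l2_dist f g)%E ->
  4 <= resolution s m /\
  forall kappa : nat, kappa%:R <= resolution s m <= 2 * kappa%:R ->
  32 * a * noise_level R d kappa <=
    m%:R * drift_sqr (@bin_law R d kappa f) (@bin_law R d kappa g).

(** If the resolution is less than 2 q, the required separation exceeds the
    largest possible L2 distance, so there is nothing to detect. Otherwise kappa
    is at least q, half of the squared separation absorbs the smoothing bias, and
    the other half makes the drift as large as the noise requires. *)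
Lemma drift_detected s : 0 < s -> exists2 C : R, 0 < C & detects s C.
Proof.
move=> s0; have [A A0 polyA] := increment_const_exists R (strict_floor s).
have [q q2 qlarge] : exists2 q, (2 <= q)%N & 4 * A * d%:R <= q%:R.
  exists (Num.truncn (4 * A * d%:R)).+2 => //.
  by rewrite ltW // (lt_trans (truncnS_gt _)) // ltr_nat.
pose B := bias_const d q s L; pose G : R := (2 * q%:R) ^+ d.
have Q0 : 0 < 2 * q%:R :> R by rewrite mulr_gt0 // ltr0n (ltnW q2).
have B0 : 0 <= B.
  by rewrite addr_ge0 // !mulr_ge0 ?powR_ge0 // ltW.
have G1 : 1 <= G.
  by rewrite exprn_ege1 // -natrM ler1n muln_gt0 (ltnW q2).
pose Z := (2 * q%:R : R) `^ s; have Z0 : 0 < Z by rewrite powR_gt0.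
pose T := (2 : R) `^ s; have T0 : 0 < T by rewrite powR_gt0.
(* the summands serve the vacuous case, the bias and the noise, in this order *)
pose C := 2 * Z * (2 * L + 1) + 4 * B * T + 1024 * G.
have ZL : 0 < 2 * Z * (2 * L + 1).
  by rewrite !mulr_gt0 // addr_gt0 // mulr_gt0.
have BT : 0 <= 4 * B * T by rewrite !mulr_ge0 // ltW.
have C1 : 1 <= C by rewrite /C; lra.
have C0 : 0 < C by apply: lt_le_trans C1.
exists C => // m a eps f g m0 a1 fH gH eps_ge eps_le.
have a0 : 0 < a by apply: lt_le_trans a1.
have mR : 0 < m%:R :> R by rewrite ltr0n.
set n := resolution s m; have n0 : 0 < n by rewrite powR_gt0.
pose X := n `^ (- s); have X0 : 0 < X by rewrite powR_gt0.
rewrite resolution_rate // -/n -/X in eps_ge.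
have eps0 : 0 <= eps by apply: le_trans eps_ge; rewrite !mulr_ge0 // ltW.
have n_large : 2 * q%:R <= n.
  rewrite leNgt; apply/negP => nq.
  have := l2_dist_hoelder_le fH gH eps0 eps_le; apply/negP; rewrite -ltNge.
  have XZ : Z^-1 <= X.
    rewrite /X powRN lef_pV2 ?posrE ?powR_gt0 // /Z.
    by apply: ge0_ler_powR; rewrite ?nnegrE ?(ltW nq) ?(ltW n0) ?(ltW Q0) ?(ltW s0).
  have ZX : 1 <= Z * X by rewrite -(mulfV (lt0r_neq0 Z0)) ler_pM2l.
  apply: lt_le_trans eps_ge.
  apply: (@lt_le_trans _ _ (2 * Z * (2 * L + 1) * 2^-1 * X)).
    rewrite (_ : _ * X = (2 * L + 1) * (Z * X)); last by field.
    apply: (@lt_le_trans _ _ (2 * L + 1)); first by rewrite ltrDl.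
    by rewrite ler_peMr // addr_ge0 // mulr_ge0 // ltW.
  rewrite ler_wpM2r ?(ltW X0) // ler_pM ?(ltW ZL) ?invr_ge0 //.
  by rewrite /C; lra.
split.
  by apply: le_trans n_large; rewrite -natrM ler_nat (leq_mul2l 2 2).
move=> kappa /andP[kn nk].
have qk : (q <= kappa)%N.
  by rewrite -(ler_nat R) -(ler_pM2l (_ : 0 < 2 :> R)) // (le_trans n_large).
have k0 : (0 < kappa)%N by exact: leq_trans (ltnW q2) qk.
have kR : 0 < kappa%:R :> R by rewrite ltr0n.
have := smoothing_bias k0 q2 s0 (ltW L_gt0) A0 polyA fH gH qlarge qk eps0 eps_le.
set r := drift_sqr _ _; rewrite -/B -/G => bias.
(* kappa is at least n / 2, whence the factor 2 ^ s *)
have deltaX : (kappa%:R^-1 : R) `^ s <= T * X.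
  rewrite /X -[- s]mulN1r powRrM powR_inv1 ?(ltW n0) // /T -powRM ?invr_ge0 ?(ltW n0) //.
  apply: ge0_ler_powR; rewrite ?nnegrE ?invr_ge0 ?mulr_ge0 ?invr_ge0 ?(ltW n0) ?(ltW s0) //.
  by rewrite ler_pdivlMr // mulrC ler_pdivrMr.
pose b := B * (kappa%:R^-1 : R) `^ s.
have b0 : 0 <= b by rewrite mulr_ge0 ?powR_ge0.
have b_le : 2 * b <= eps.
  apply: le_trans eps_ge; apply: (@le_trans _ _ (4 * B * T * 2^-1 * X)).
    by have := ler_wpM2l B0 deltaX; rewrite -/b; lra.
  rewrite ler_wpM2r ?(ltW X0) // ler_pM ?invr_ge0 //.
  by rewrite /C; lra.
pose W : R := kappa%:R `^ (d%:R / 2).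
have W0 : 0 < W by rewrite powR_gt0.
have WE : kappa%:R ^+ d = W ^+ 2.
  by rewrite /W -[RHS]powR_mulrn ?powR_ge0 // -powRrM divfK // powR_mulrn // ltW.
have noiseE : noise_level R d kappa = W^-1 by rewrite /noise_level powRN.
have mX : W <= m%:R * X ^+ 2.
  rewrite /X resolution_balance // -/n; apply: ge0_ler_powR; rewrite ?nnegrE ?(ltW kR) ?(ltW n0) //.
rewrite -/b WE in bias.
have eps2 : C ^+ 2 * a ^+ 2 * X ^+ 2 <= eps ^+ 2.
  by rewrite -!exprMn lerXn2r ?nnegrE // !mulr_ge0 // ltW.
have half : eps ^+ 2 <= 16 * G * W ^+ 2 * r.
  have : 4 * b ^+ 2 <= eps ^+ 2.
    by rewrite (_ : 4 * b ^+ 2 = (2 * b) ^+ 2); [rewrite lerXn2r ?nnegrE ?mulr_ge0|ring].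
  by move: bias; lra.
have key : C ^+ 2 * a ^+ 2 * W <= 16 * G * W ^+ 2 * (m%:R * r).
  apply: (@le_trans _ _ (m%:R * (C ^+ 2 * a ^+ 2 * X ^+ 2))).
    by rewrite [leRHS]mulrCA ler_wpM2l // -exprMn sqr_ge0.
  rewrite (_ : 16 * G * W ^+ 2 * (m%:R * r) = m%:R * (16 * G * W ^+ 2 * r)); last by ring.
  by rewrite ler_wpM2l ?(ltW mR) // (le_trans eps2).
have Ca : 512 * G <= C ^+ 2 * a.
  apply: (@le_trans _ _ (C * 2^-1)); first by rewrite /C; lra.
  by rewrite expr2 ler_pM ?invr_ge0 ?(ltW C0) // ler_peMl // ltW.
rewrite noiseE -/W ler_pdivrMr //.
have WG : 0 < 16 * G * W by rewrite !mulr_gt0 // (lt_le_trans _ G1).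
rewrite -(ler_pM2l WG); apply: (@le_trans _ _ (C ^+ 2 * a ^+ 2 * W)).
  rewrite (_ : 16 * G * W * (32 * a) = 512 * G * (a * W)); last by ring.
  rewrite (_ : C ^+ 2 * a ^+ 2 * W = C ^+ 2 * a * (a * W)); last by ring.
  by rewrite ler_wpM2r // mulr_ge0 // ltW.
by apply: (le_trans key); rewrite le_eqVlt; apply/orP; left; apply/eqP; ring.
Qed.

End detection.

(** * Risk of the tests *)

Lemma sup0_le (R : realType) (S : set (\bar R)) (c : R) : 0 <= c ->
  (forall x, S x -> (x <= c%:E)%E) -> (sup0 S <= c%:E)%E.
Proof.
by move=> c0 Sc; rewrite /sup0 ge_max lee_fin c0 /=; apply: ge_ereal_sup => x /Sc.
Qed.

Lemma risk_le (R : realType) (d m : nat) eps phi (H : set (point R d -> R)) (alpha beta : R) :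
  0 <= alpha -> 0 <= beta ->
  (forall f : density R d, H f -> (two_sample_expectation (m := m) f f phi <= alpha%:E)%E) ->
  (forall f g : density R d, H f -> H g -> (eps%:E <= l2_dist f g)%E ->
    (two_sample_expectation f g (fun z => 1 - phi z)%R <= beta%:E)%E) ->
  (risk eps phi H <= (alpha + beta)%:E)%E.
Proof.
move=> alpha0 beta0 type1 type2; rewrite /risk EFinD; apply: leeD; apply: sup0_le => //.
  by move=> _ [f Hf <-]; exact: type1.
by move=> _ [[f g] [Hf Hg fg] <-]; exact: type2.
Qed.

Section tests.
Context (R : realType) (d : nat) (L : R).
Hypothesis d_ge1 : (1 <= d)%N.
Hypothesis L_gt0 : 0 < L.

Lemma hoelder_density_le s (f : density R d) : hoelder_class s L f ->
  forall x, unit_cube x -> f x <= L.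
Proof. by move=> fH x x01; apply: le_trans (hoelder_bounded fH x01); exact: ler_norm. Qed.

Lemma resolution_ge1 (s : R) m : 0 < s -> (0 < m)%N -> 1 <= resolution d s m.
Proof.
move=> s0 m0; rewrite (_ : 1 = 1 `^ (2 / (4 * s + d%:R))); last by rewrite powR1.
apply: ge0_ler_powR; rewrite ?nnegrE ?ler1n //.
by rewrite divr_ge0 // addr_ge0 // mulr_ge0 // ltW.
Qed.

Lemma resolution_m_gt1 (s : R) m : 4 <= resolution d s m -> (1 < m)%N.
Proof.
rewrite /resolution; case: m => [|[|//]]; last first.
  by rewrite powR1 => /(le_trans _) h; have := h 2; lra.
by have [->|D0] := eqVneq (2 / (4 * s + d%:R)) 0; rewrite ?powRr0 ?powR0 //; lra.
Qed.

Lemma indicator_le (b c : bool) : (b -> c) -> 0 <= (b%:R : R) <= c%:R.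
Proof. by case: b; case: c => // H; rewrite ?lexx ?ler01 //; have := H isT. Qed.

(** The integer part of a real n >= 1 lies between n / 2 and n, as detects
    requires. *)
Lemma single_scale_risk_le C (s : R) m (a eps : R) :
  detects d L s C -> 0 < s -> (1 <= m)%N -> 1 <= a ->
  C * a * m%:R `^ (- (2 * s / (4 * s + d%:R))) <= eps ->
  (risk eps (@single_scale_test R d m s a) (@hoelder_class R d s L)
     <= (67 * L / a ^+ 2)%:E)%E.
Proof.
move=> detect s0 m0 a1 eps_ge.
have a0 : 0 < a by apply: lt_le_trans a1.
have n1 := resolution_ge1 s0 m0.
set n := resolution d s m in n1 detect *.
have nk : (single_scale d m s)%:R <= n < (single_scale d m s).+1%:R.
  by apply: truncn_itv; apply: le_trans n1.
have k0 : (0 < single_scale d m s)%N by rewrite truncn_gt0.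
set kappa := single_scale d m s in nk k0.
have c0 (c : R) : 0 <= c -> 0 <= c * L / a ^+ 2.
  by move=> c0; rewrite divr_ge0 ?sqr_ge0 // mulr_ge0 // ltW.
rewrite (_ : 67 * L / a ^+ 2 = 32 * L / a ^+ 2 + 35 * L / a ^+ 2); last by field; rewrite gt_eqF.
apply: risk_le; rewrite ?c0 //.
  move=> f fH; apply: (false_alarm_le k0 (ltW L_gt0) (F := fun x =>
    (2 * m%:R + a * m%:R * noise_level R d kappa < x)%R%:R)) => //.
    exact: hoelder_density_le fH.
  by move=> x; apply: indicator_le => /ltW.
move=> f g fH gH fg.
have a12 : 2^-1 <= a by apply: le_trans a1; rewrite invf_le1 // ler1n.
have [n4 drift] := detect m a eps f g m0 a12 fH gH eps_ge fg.
apply: (miss_le k0 (ltW L_gt0) (F := fun x =>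
    1 - (2 * m%:R + a * m%:R * noise_level R d kappa < x)%R%:R)) => //.
- exact: resolution_m_gt1 n4.
- exact: hoelder_density_le fH.
- exact: hoelder_density_le gH.
- apply: drift; have /andP[-> nk1] := nk; apply: (le_trans (ltW nk1)).
  by rewrite -natrM ler_nat mul2n -addnn -addn1 leq_add2l.
- move=> x; rewrite (_ : 1 - _ = (x <= 2 * m%:R + a * m%:R * noise_level R d kappa)%R%:R).
    exact: indicator_le.
  by rewrite leNgt; case: (_ < x); rewrite /= ?subrr ?subr0.
Qed.

Lemma ln2_ge_half : 2^-1 <= ln 2 :> R.
Proof.
have : ln (1 + - 2^-1) <= - 2^-1 :> R by apply: le_ln1Dx; lra.
rewrite (_ : 1 + - 2^-1 = 2^-1); last by field.
by rewrite lnV ?posrE // lerN2.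
Qed.

Section multiscale.
Variables (m : nat) (a : R).
Hypothesis m_ge2 : (2 <= m)%N.
Hypothesis a_ge1 : 1 <= a.

Let a_gt0 : 0 < a. Proof. exact: lt_le_trans a_ge1. Qed.

Let ln_m : 2^-1 <= ln m%:R :> R.
Proof.
apply: le_trans ln2_ge_half _; rewrite ler_ln ?posrE ?ltr0n ?ler_nat //.
exact: ltnW.
Qed.

(** The multiscale test runs each scale at this level. The extra factor
    ln m in its square pays for the union bound over the scales. It may be less
    than 1 when m = 2, but it is at least 1 / 2, which suffices for detects. *)
Definition adaptive_level : R := a * (ln m%:R) `^ 2^-1.

Lemma adaptive_level_sqr : adaptive_level ^+ 2 = a ^+ 2 * ln m%:R.
Proof.
have ln0 : 0 <= ln m%:R :> R by apply: le_trans ln_m.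
by rewrite /adaptive_level exprMn powR12_sqrt // sqr_sqrtr.
Qed.

Lemma adaptive_level_ge : 2^-1 <= adaptive_level.
Proof.
rewrite -(ler_pXn2r (_ : (0 < 2)%N)) ?nnegrE //; last first.
  by rewrite mulr_ge0 ?powR_ge0 // ltW.
rewrite adaptive_level_sqr; have : 1 <= a ^+ 2 by rewrite exprn_ege1.
by move: ln_m; nra.
Qed.

Lemma multiscale_thresholdE kappa : multiscale_threshold d m a kappa =
  2 * m%:R + adaptive_level * m%:R * noise_level R d kappa.
Proof. by rewrite /multiscale_threshold /adaptive_level /noise_level; ring. Qed.

Let alarm b (x : R) : R := (multiscale_threshold d m a (2 ^ b) <= x)%R%:R.

Let sample := (m.-tuple (point R d) * m.-tuple (point R d))%type.

Let alarm_at b (z : sample) := alarm b (chi2_stat (2 ^ b) z).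

Let measurable_alarm b : measurable_fun [set: sample] (alarm_at b).
Proof. exact: (@measurable_chi2_fun R d (2 ^ b) m (alarm b)). Qed.

Let measurable_multiscale : measurable_fun [set: sample] (@multiscale_test R d m a).
Proof.
rewrite /multiscale_test; elim: (index_iota _ _) => [|b r IH].
  by under eq_fun do rewrite big_nil; exact: measurable_cst.
under eq_fun do rewrite big_cons.
by apply: measurable_maxr => //; exact: measurable_alarm.
Qed.

Let alarm_ge0 b z : 0 <= alarm_at b z. Proof. by []. Qed.

Lemma multiscale_test_le_sum (z : sample) :
  multiscale_test a z <= \sum_(1 <= b < (max_scale R d m).+1) alarm_at b z.
Proof.
rewrite /multiscale_test; elim: (index_iota _ _) => [|b r IH]; first by rewrite !big_nil.
rewrite !big_cons ge_max; apply/andP; split.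
  by rewrite lerDl; apply: sumr_ge0.
by apply: (le_trans IH); rewrite lerDr.
Qed.

Lemma multiscale_test_ge (z : sample) b : (1 <= b <= max_scale R d m)%N ->
  alarm_at b z <= multiscale_test a z.
Proof.
move=> b_range; rewrite /multiscale_test.
by apply: (le_bigmax_seq _ b) => //; rewrite mem_index_iota ltnS.
Qed.

Lemma max_scale_le : (max_scale R d m)%:R <= 4 * ln m%:R :> R.
Proof.
have l0 : 0 < ln m%:R :> R by apply: lt_le_trans ln_m; rewrite invr_gt0.
have l2 : 0 < ln 2 :> R by apply: lt_le_trans ln2_ge_half; rewrite invr_gt0.
have dR : 1 <= d%:R :> R by rewrite ler1n.
have d0 : 0 < d%:R :> R by apply: lt_le_trans dR.
apply: (@le_trans _ _ (2 / d%:R * (ln m%:R / ln 2))).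
  by rewrite truncn_le !mulr_ge0 ?invr_ge0 // ltW.
rewrite mulrCA mulrC ler_wpM2r ?(ltW l0) //.
rewrite ler_pdivrMr // (@le_trans _ _ 2) //.
  by rewrite ler_pdivrMr // ler_peMr.
by move: ln2_ge_half; lra.
Qed.

(** A union bound: there are at most 4 ln m scales, and each raises a false alarm
    with probability of order a ^ -2 / ln m. *)
Lemma multiscale_false_alarm_le s (f : density R d) : hoelder_class s L f ->
  (two_sample_expectation f f (@multiscale_test R d m a) <= (128 * L / a ^+ 2)%:E)%E.
Proof.
move=> fH; set N := max_scale R d m.
have m0 : (0 < m)%N by apply: ltnW.
have inf0 : 0 < adaptive_level by apply: lt_le_trans adaptive_level_ge; rewrite invr_gt0.
have lnm0 : 0 < ln m%:R :> R by apply: lt_le_trans ln_m; rewrite invr_gt0.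
apply: (@le_trans _ _ (\sum_(1 <= b < N.+1) two_sample_expectation f f (alarm_at b))%E).
  rewrite /two_sample_expectation unlock.
  rewrite -ge0_integral_sum //; last 2 first.
  - by move=> b; apply/measurable_EFinP; exact: measurable_alarm.
  - by move=> b z _; rewrite lee_fin.
  apply: ge0_le_integral => //.
  - move=> z _; rewrite lee_fin /multiscale_test.
    by elim/big_ind : _ => // x y x0 y0; rewrite le_max x0.
  - by apply/measurable_EFinP; exact: measurable_multiscale.
  - apply: emeasurable_sum => b; apply/measurable_EFinP; exact: measurable_alarm.
  - by move=> z _; rewrite sumEFin lee_fin multiscale_test_le_sum.
apply: (@le_trans _ _ (\sum_(1 <= b < N.+1) (32 * L / adaptive_level ^+ 2)%:E)%E).
  apply: lee_sum => b _.
  apply: (false_alarm_le _ (ltW L_gt0) inf0 m0 (hoelder_density_le fH)).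
    by rewrite expn_gt0.
  by move=> x; apply: indicator_le; rewrite /alarm multiscale_thresholdE.
rewrite sumEFin lee_fin sumr_const_nat subSS subn0 -[leLHS]mulr_natl adaptive_level_sqr.
apply: (@le_trans _ _ (4 * ln m%:R * (32 * L / (a ^+ 2 * ln m%:R)))).
  by rewrite ler_wpM2r ?max_scale_le // divr_ge0 // mulr_ge0 ?sqr_ge0 ?(ltW L_gt0) ?(ltW lnm0).
by rewrite le_eqVlt; apply/orP; left; apply/eqP; field; rewrite !gt_eqF.
Qed.

(** The largest power of 2 below the resolution is among the scales because the
    resolution is at most m ^ (2 / d), whatever the smoothness. *)
Lemma dyadic_scale_exists (s : R) : 0 < s -> 4 <= resolution d s m ->
  exists2 b, (1 <= b <= max_scale R d m)%N &
    (2 ^ b)%:R <= resolution d s m <= 2 * (2 ^ b)%:R.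
Proof.
move=> s0; set n := resolution d s m => n4.
have n0 : 0 <= n by apply: le_trans n4.
have /andP[Nn nN] := truncn_itv n0; set N := Num.truncn n in Nn nN.
have N4 : (4 <= N)%N by rewrite truncn_ge_nat.
have Npos : (0 < N)%N by apply: leq_trans N4.
have bN := trunc_logP (ltnSn 1) Npos.
have Nb := trunc_log_ltn N (ltnSn 1).
set b := trunc_log 2 N in bN Nb.
have bn : (2 ^ b)%:R <= n by apply: le_trans Nn; rewrite ler_nat.
exists b; last first.
  by rewrite bn /= (le_trans (ltW nN)) // -natrM -expnS ler_nat.
apply/andP; split; first by apply: trunc_log_max => //; apply: leq_trans N4.
have l0 : 0 < ln m%:R :> R by apply: lt_le_trans ln_m; rewrite invr_gt0.
have l2 : 0 < ln 2 :> R by apply: lt_le_trans ln2_ge_half; rewrite invr_gt0.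
have d0 : 0 < d%:R :> R by rewrite ltr0n.
rewrite /max_scale truncn_ge_nat; last by rewrite !mulr_ge0 ?invr_ge0 // ltW.
rewrite mulrA ler_pdivlMr //.
have lnb : b%:R * ln 2 <= 2 / (4 * s + d%:R) * ln m%:R :> R.
  rewrite mulr_natl -lnXn // -natrX -ln_powR ler_ln ?posrE //.
  exact: lt_le_trans n4.
apply: (le_trans lnb).
rewrite ler_wpM2r ?(ltW l0) // ler_pM2l // lef_pV2 ?posrE //.
  by rewrite lerDr mulr_ge0 // ltW.
by rewrite addr_gt0 // mulr_gt0.
Qed.

(** For a miss, the single scale given by dyadic_scale_exists must stay silent. *)
Lemma multiscale_risk_le C (s eps : R) : detects d L s C -> 0 < s ->
  C * a * (ln m%:R) `^ 2^-1 * m%:R `^ (- (2 * s / (4 * s + d%:R))) <= eps ->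
  (risk eps (@multiscale_test R d m a) (@hoelder_class R d s L)
     <= (198 * L / a ^+ 2)%:E)%E.
Proof.
move=> detect s0 eps_ge.
have c0 (c : R) : 0 <= c -> 0 <= c * L / a ^+ 2.
  by move=> c0; rewrite divr_ge0 ?sqr_ge0 // mulr_ge0 // ltW.
rewrite (_ : 198 * L / a ^+ 2 = 128 * L / a ^+ 2 + 70 * L / a ^+ 2); last first.
  by field; rewrite gt_eqF.
have m0 : (0 < m)%N by apply: ltnW.
have inf0 : 0 < adaptive_level by apply: lt_le_trans adaptive_level_ge; rewrite invr_gt0.
apply: risk_le; rewrite ?c0 //; first exact: multiscale_false_alarm_le.
move=> f g fH gH fg.
have eps_ge' : C * adaptive_level * m%:R `^ (- (2 * s / (4 * s + d%:R))) <= eps.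
  by rewrite /adaptive_level mulrA.
have [n4 drift] := detect m adaptive_level eps f g m0 adaptive_level_ge fH gH eps_ge' fg.
have [b b_range bn] := dyadic_scale_exists s0 n4.
have test_le1 z : multiscale_test a z <= 1 :> R.
  rewrite /multiscale_test; elim/big_ind : _ => [|x y x1 y1|b' _] //.
    by rewrite ge_max x1.
  by rewrite lern1 leq_b1.
apply: (@le_trans _ _ (two_sample_expectation f g (fun z => 1 - alarm_at b z)%R)).
  rewrite /two_sample_expectation unlock; apply: ge0_le_integral => //.
  - by move=> z _; rewrite lee_fin subr_ge0.
  - apply/measurable_EFinP; apply: measurable_funB => //; exact: measurable_multiscale.
  - apply/measurable_EFinP; apply: measurable_funB => //; exact: measurable_alarm.
  - by move=> z _; rewrite lee_fin lerB // multiscale_test_ge.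
apply: (@le_trans _ _ (35 * L / adaptive_level ^+ 2)%:E).
  apply: (miss_le _ (ltW L_gt0) (F := fun x => 1 - alarm b x)) => //.
  - by rewrite expn_gt0.
  - exact: hoelder_density_le fH.
  - exact: hoelder_density_le gH.
  - exact: drift.
  - move=> x; rewrite /alarm multiscale_thresholdE.
    rewrite (_ : 1 - _ = (x < 2 * m%:R + adaptive_level * m%:R * noise_level R d (2 ^ b))%R%:R).
      by apply: indicator_le => /ltW.
    by rewrite ltNge; case: (_ <= x); rewrite /= ?subrr ?subr0.
have lnm0 : 0 < ln m%:R :> R by apply: lt_le_trans ln_m; rewrite invr_gt0.
rewrite lee_fin adaptive_level_sqr ler_pdivrMr; last by rewrite mulr_gt0 // exprn_gt0.
rewrite (_ : _ * (a ^+ 2 * _) = 70 * L * ln m%:R); last by field; rewrite gt_eqF.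
by move: ln_m L_gt0; nra.
Qed.

End multiscale.
End tests.

Theorem proposition1 (R : realType) (d : nat) (L : R) (d_ge1 : (1 <= d)%N) (L_gt0 : 0 < L) :
  exists (c1 : R) (c2 : R -> R),
  [/\ 0 < c1,
      forall s, 0 < s -> 0 < c2 s,
      forall (m : nat) (a : R) (eps : R -> R), (2 <= m)%N -> 1 <= a ->
        (forall s, 0 < s ->
          c2 s * a * (ln m%:R) `^ 2^-1 * m%:R `^ (- (2 * s / (4 * s + d%:R)))
            <= eps s) ->
        (ereal_sup [set risk (eps s) (@multiscale_test R d m a) (@hoelder_class R d s L)
                   | s in [set s : R | (0 < s)%R]]
          <= (c1 / a ^+ 2)%:E)%E &
      exists2 c1' : R, 0 < c1' &
        forall (s : R) (m : nat) (a eps : R), 0 < s -> (1 <= m)%N -> 1 <= a ->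
        c2 s * a * m%:R `^ (- (2 * s / (4 * s + d%:R))) <= eps ->
        (risk eps (@single_scale_test R d m s a) (@hoelder_class R d s L)
          <= (c1' / a ^+ 2)%:E)%E].
Proof.
have /choice[C CP] : forall s : R, exists c, 0 < s -> 0 < c /\ detects d L s c.
  move=> s; have [s0|s0] := ltP 0 s; last by exists 0.
  by have [c c0 cP] := drift_detected d L_gt0 s0; exists c.
exists (198 * L), C; split.
- by rewrite mulr_gt0.
- by move=> s s0; have [] := CP s s0.
- move=> m a eps m2 a1 eps_ge; apply: ge_ereal_sup => _ [s /= s0 <-].
  have [_ Cs] := CP s s0; exact: multiscale_risk_le Cs s0 (eps_ge s s0).
- exists (67 * L); first by rewrite mulr_gt0.
  move=> s m a eps s0 m1 a1 eps_ge; have [_ Cs] := CP s s0.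
  exact: single_scale_risk_le Cs s0 m1 a1 eps_ge.
Qed.
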